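(* Let $Q_M(s)=A+2sB+s^2C$ and $Q_{\tilde M}(s)=\tilde A+2s\tilde B+s^2\tilde C$ be characteristic polynomials of almost causally isometric unipotent manifolds $M$ and $\tilde M$, and let $C>0$, $\tilde C>0$. Then the eigenvalues of $BC^{-1}$ and $\tilde B\tilde C^{-1}$ are real and $$\operatorname{sp}\big(BC^{-1}\big)=\alpha\big(\operatorname{sp}\big(\tilde B\tilde C^{-1}\big)\big)$$ for some affine transformation $\alpha\in\operatorname{Aff}(\mathbb{R})$ of the real line.
   Context: $\operatorname{sp}(X)$ denotes the spectrum of a matrix $X$; $S>0$ means that $S$ is symmetric positive definite. Main construction. Let $V$ be a real vector space of dimension $n\ge 2$ with a symmetric bilinear form $\ell$ of signature $(+,-,\dots,-)$, and let $\mathcal C$ be one of the two closed convex cones whose union is $\{v:\ell(v,v)\ge0\}$. Let $v_0,v_1\in\partial \mathcal C$ satisfy $\ell(v_0,v_1)=1$ and put $L=\mathbb{R}v_0$, $W=L^\perp$, $N=W\cap v_1^\perp$, $l_0(v)=\ell(v_0,v)$ (orthogonal complements are with respect to $\ell$; $\ell$ is negative definite on $N$). Let $T\subseteq N$ be a linear subspace, $\Gamma$ a lattice (cocompact discrete subgroup) in $T$, and $a:T\to N$ a linear map with $\ell(ax,y)=\ell(x,ay)$ for $x,y\in T$ and $\ker(\mathbf 1+sa)=0$ for all $s\in\mathbb{R}$, where $(\mathbf 1+sa)x=x+s\,ax$. The vector group $T$ acts on $V$ by $\gamma_x(v)=\lambda(x)v+\tau(x)$, $x\in T$, where $$\lambda(x)v=v+l_0(v)ax-\Big(\ell(ax,v)+\tfrac12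 l_0(v)\ell(ax,ax)\Big)v_0,\qquad \tau(x)=x-\tfrac12\ell(ax,x)v_0.$$ Under these conditions $\Gamma$ acts on $V$ freely and properly by $x\mapsto\gamma_x$; the quotient $M=M(v_0,v_1,T,a,\Gamma)=V/\Gamma$ is a Lorentzian manifold with the metric induced by $\ell$ and the field of cones induced by $\mathcal C$. A unipotent manifold is a Lorentzian manifold (with cone field) that admits a realization $M(v_0,v_1,T,a,\Gamma)$ (up to causal isometry, i.e. an isometry preserving the orientation of timelike curves). Two unipotent manifolds are almost causally isometric if they admit realizations $M(v_0,v_1,T,a,\Gamma)$ and $M(v_0,v_1,T,a,\tilde\Gamma)$ that differ only in the choice of the lattice in $T$. Characteristic polynomial. Choose a realization of $M$ and, with $m=\dim T$, a linear isomorphism $\iota:\mathbb{R}^m\to T$ with $\iota\,\mathbb{Z}^m=\Gamma$. For $x\in T$, $s\in\mathbb{R}$ put $q_s(x)=-\ell((\mathbf 1+sa)x,(\mathbf 1+sa)x)$. There are unique symmetric real $m\times m$ matrices $A,B,C$ such that $q_s(\iota z)=\langle (A+2sB+s^2C)z,z\rangle$ for all $z\in\mathbb{R}^m$, $s\in\mathbb{R}$, where $\langle\cdot,\cdot\rangle$ is the standard inner product. Then $Q_M(s)=A+2sB+s^2C$ is called a characteristic polynomial of $M$ (it depends on the realization and on $\iota$, and is considered up to orientation-preserving affine changes of $s$). *)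

(* Defs.v *)
(* MathComp / MathComp-Analysis *)
From HB Require Import structures.
From mathcomp Require Import all_boot all_order all_algebra.
From mathcomp Require Import complex.
From mathcomp Require Import all_classical all_reals all_analysis.
Import Order.TTheory GRing.Theory Num.Theory numFieldNormedType.Exports.

Set Implicit Arguments.
Unset Strict Implicit.
Unset Printing Implicit Defensive.

Local Open Scope classical_set_scope.
Local Open Scope ring_scope.

(** * Lorentzian vector space

    The real vector space of dimension [n] is modelled on ['rV[R]_n], with its
    canonical topology and differential calculus; the form is arbitrary. *)

Section Lorentz.
Variables (R : realType) (n : nat).
Local Notation V := 'rV[R]_n.

(* Signature (+,-,...,-): the rows of [P] form a basis in which the Gram
   matrix is diag(1,-1,...,-1). *)
Definition lorentzian (l : V -> V -> R) : Prop :=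
  exists2 P : 'M[R]_n, P \in unitmx &
    forall i j : 'I_n, l (row i P) (row j P) =
      if i == j then (if val i == 0%N then 1 else -1) else 0.

Definition closed_convex_cone (K : set V) : Prop :=
  [/\ closed K, convex_set K
    & forall (t : R) (v : V), 0 <= t -> K v -> K (t *: v)].

Definition is_causal_cone (l : V -> V -> R) (K : set V) : Prop :=
  closed_convex_cone K /\
  exists2 K' : set V, closed_convex_cone K' &
    K `|` K' = [set v | 0 <= l v v].

Definition boundary (K : set V) : set V := closure K `\` interior K.

Fixpoint Ck_on (k : nat) (U : set V) (F : V -> V) : Prop :=
  match k with
  | 0%N => forall x, U x -> {for x, continuous F}
  | k'.+1 => (forall x, U x -> differentiable F x) /\
             (forall v : V, Ck_on k' U (fun x => 'D_v F x))
  end.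

Definition smooth_on (U : set V) (F : V -> V) : Prop :=
  forall k, Ck_on k U F.

End Lorentz.

(** * Unipotent manifolds *)

(* [W `&` v1^perp] with [W = (R v0)^perp]. *)
Definition Nset (R : realType) (n : nat) (l : 'rV[R]_n -> 'rV[R]_n -> R)
    (v0 v1 : 'rV[R]_n) : set 'rV[R]_n :=
  [set v | l v0 v = 0 /\ l v1 v = 0].

(* Everything in [M(v0,v1,T,a,Gamma)] except the lattice.  The linear map [a] is
   defined on [T] only, whose elements form the type [subvs_of Tsp] with
   inclusion [vsval]. *)
Record unipotent_data (R : realType) (n : nat) := UnipotentData {
  lform : {symmetric 'rV[R]_n};
  lform_lorentzian : lorentzian lform;
  cone : set 'rV[R]_n;
  coneP : is_causal_cone lform cone;
  v0 : 'rV[R]_n;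
  v1 : 'rV[R]_n;
  v0_boundary : boundary cone v0;
  v1_boundary : boundary cone v1;
  lform_v0_v1 : lform v0 v1 = 1;
  Tsp : {vspace 'rV[R]_n};
  Tsp_sub_N : forall x : subvs_of Tsp, Nset lform v0 v1 (vsval x);
  amap : {linear subvs_of Tsp -> 'rV[R]_n};
  amap_sub_N : forall x : subvs_of Tsp, Nset lform v0 v1 (amap x);
  amap_sym : forall x y : subvs_of Tsp,
    lform (amap x) (vsval y) = lform (vsval x) (amap y);
  amap_ker : forall (s : R) (x : subvs_of Tsp),
    vsval x + s *: amap x = 0 -> x = 0
}.

Section Action.
Variables (R : realType) (n : nat) (D : unipotent_data R n).
Local Notation V := 'rV[R]_n.
Local Notation l := (lform D).

Definition l0 (v : V) : R := l (v0 D) v.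

Definition lambda (x : subvs_of (Tsp D)) (v : V) : V :=
  v + l0 v *: amap D x
    - (l (amap D x) v + 2^-1 * l0 v * l (amap D x) (amap D x)) *: v0 D.

Definition tau (x : subvs_of (Tsp D)) : V :=
  vsval x - (2^-1 * l (amap D x) (vsval x)) *: v0 D.

Definition gamma (x : subvs_of (Tsp D)) (v : V) : V := lambda x v + tau x.

Definition qform (s : R) (x : subvs_of (Tsp D)) : R :=
  - l (vsval x + s *: amap D x) (vsval x + s *: amap D x).

Definition is_lattice (G : set (subvs_of (Tsp D))) : Prop :=
  [/\ G 0,
      forall x y, G x -> G y -> G (x - y),
      (forall x, G x -> exists2 U : set V, nbhs (vsval x) U &
         forall y, G y -> U (vsval y) -> y = x)
    & exists2 K : set V, compact K &
        K `<=` [set` Tsp D] /\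
        forall x : subvs_of (Tsp D), exists g, G g /\ K (vsval (x - g))].

End Action.

Record unipotent_manifold (R : realType) (n : nat) := UnipotentManifold {
  udata : unipotent_data R n;
  lattice : set (subvs_of (Tsp udata));
  latticeP : is_lattice lattice
}.
Arguments lattice {R n} u.

Section Isometry.
Variables (R : realType) (n : nat).
Local Notation V := 'rV[R]_n.
Implicit Types M : unipotent_manifold R n.

(* The canonical projection of [V] onto [V / Gamma]. *)
Definition proj M (v : V) : set V := [set gamma x v | x in lattice M].

Definition points M : set (set V) := range (proj M).

(* The local inverses of [proj] are the charts of [V / Gamma]: [F] is the
   expression of [f] in such charts, and in them the metric and the field of
   cones are the constant ones of [V].  A bijection that is a local isometry is
   a diffeomorphism, by the inverse function theorem. *)
Definition is_causal_isometry M M' (f : set V -> set V) : Prop :=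
  set_bij (points M) (points M') f /\
  forall p : V, exists (U : set V) (F : V -> V),
    [/\ open_nbhs p U,
        smooth_on U F,
        forall x, U x -> f (proj M x) = proj M' (F x),
        forall x, U x -> forall u v : V,
          lform (udata M') ('d F x u) ('d F x v) = lform (udata M) u v
      & forall x, U x -> forall v : V,
          cone (udata M) v -> cone (udata M') ('d F x v)].

Definition causally_isometric M M' : Prop :=
  exists f, is_causal_isometry M M' f.

Definition almost_causally_isometric M M' : Prop :=
  exists (D : unipotent_data R n) (G G' : set (subvs_of (Tsp D)))
         (GP : is_lattice G) (GP' : is_lattice G'),
    causally_isometric M (UnipotentManifold GP) /\
    causally_isometric M' (UnipotentManifold GP').

End Isometry.

(** * Characteristic polynomials *)

Section CharacteristicPolynomial.
Variables (R : realType) (n : nat).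

Definition inner (m : nat) (y z : 'cV[R]_m) : R := (y^T *m z) 0 0.

Definition posdef (m : nat) (S : 'M[R]_m) : Prop :=
  S^T = S /\ forall z : 'cV[R]_m, z != 0 -> 0 < inner (S *m z) z.

Definition qpoly (m : nat) (A B C : 'M[R]_m) (s : R) : 'M[R]_m :=
  A + (2 * s) *: B + s ^+ 2 *: C.

Definition int_vectors (m : nat) : set 'cV[R]_m :=
  [set z | forall i, z i 0 \is a Num.int].

(* The bijectivity of [iota] forces [m = \dim T]. *)
Definition char_poly_realization (M : unipotent_manifold R n) (m : nat)
    (A B C : 'M[R]_m) : Prop :=
  exists iota : {linear 'cV[R]_m -> subvs_of (Tsp (udata M))},
    [/\ bijective iota,
        iota @` @int_vectors m = lattice M,
        [/\ A^T = A, B^T = B & C^T = C]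
      & forall (z : 'cV[R]_m) (s : R),
          qform s (iota z) = inner (qpoly A B C s *m z) z].

(* Any realization of [M] may be used, and the result may be changed by an
   orientation-preserving affine substitution [s |-> c * s + d]. *)
Definition is_char_poly (M : unipotent_manifold R n) (m : nat)
    (A B C : 'M[R]_m) : Prop :=
  exists (M' : unipotent_manifold R n) (A' B' C' : 'M[R]_m) (c d : R),
    [/\ causally_isometric M M', char_poly_realization M' A' B' C', 0 < c
      & forall s, qpoly A B C s = qpoly A' B' C' (c * s + d)].

(* The spectrum of a real matrix is taken over the complex numbers [R[i]]. *)
Definition sp (m : nat) (X : 'M[R]_m) : set R[i] :=
  [set z | eigenvalue (map_mx (real_complex R) X) z].

End CharacteristicPolynomial.

(* Main.v *)
Require Import Defs.
From HB Require Import structures.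
From mathcomp Require Import all_boot all_order all_algebra.
From mathcomp Require Import complex.
From mathcomp Require Import all_classical all_reals all_analysis.
From mathcomp Require Import ring lra.
Import Order.TTheory GRing.Theory Num.Theory numFieldNormedType.Exports.

(** A local isometry between (possibly different) Lorentzian vector spaces has
    vanishing second derivatives, since [l' (D_w D_u F) (D_v F)] is symmetric in
    [u, w] and skew in [u, v]; so a causal isometry of unipotent manifolds lifts
    locally to affine isometries.  Two local lifts that agree modulo the lattice
    on an open set differ by an element of the lattice, whence a global affine
    lift [F v = F 0 + v A] conjugating the two lattice actions.  If [a] does not
    vanish, [A] maps [v0] to [k v0'] because [(lambda - 1)^2] has image [R v0];
    comparing the actions modulo [v0'] then gives a linear bijection
    [Phi : T -> T'] with [q'_s (Phi x) = q_(k (s - h)) x].  Changing the lattice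
    does not affect [q], so the pencils of [M] and [Mt] satisfy
    [P^T Qt(s) P = Q(u s + w)], and comparison of the coefficients makes
    [B C^-1] similar to [u (Bt Ct^-1) - w]. *)

Set Implicit Arguments.
Unset Strict Implicit.
Unset Printing Implicit Defensive.

Local Open Scope classical_set_scope.
Local Open Scope ring_scope.

Local Notation proj := Defs.proj.
Local Notation qpoly := Defs.qpoly.

(** * Symmetry of mixed second derivatives *)

Section SecondDerivative.
Variables (R : realType) (V : normedModType R).
Implicit Types (phi : V -> R) (p u w : V).

Lemma line_is_derive phi p u (s : R) d : is_derive (p + s *: u) u phi d ->
  is_derive s 1 (fun r : R => phi (p + r *: u)) d.
Proof.
have E : (fun h : R => h^-1 *: (((fun r : R => phi (p + r *: u)) \o shift s) (h *: 1)
           - phi (p + s *: u))) =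
         (fun h => h^-1 *: ((phi \o shift (p + s *: u)) (h *: u)
           - phi (p + s *: u))).
  apply/funext => h /=; congr (_ *: (phi _ - _)).
  by rewrite [h *: 1]mulr1 scalerDl addrCA addrC -addrA.
by case=> [c <-]; apply: DeriveDef; rewrite /derivable /derive E.
Qed.

Lemma translate_is_derive phi x y u d : is_derive (x + y) u phi d ->
  is_derive x u (fun z => phi (z + y)) d.
Proof.
have E : (fun k : R => k^-1 *: (((fun z => phi (z + y)) \o shift x) (k *: u)
           - phi (x + y))) =
         (fun k => k^-1 *: ((phi \o shift (x + y)) (k *: u) - phi (x + y))).
  by apply/funext => k /=; rewrite !addrA.
by case=> [c <-]; apply: DeriveDef; rewrite /derivable /derive E.
Qed.

Lemma line_MVT phi dphi p u (t : R) : 0 < t ->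
  (forall s, 0 <= s <= t -> is_derive (p + s *: u) u phi (dphi (p + s *: u))) ->
  exists2 s, 0 <= s <= t &
    phi (p + t *: u) - phi p = t * dphi (p + s *: u).
Proof.
move=> t0 d.
have dl s : 0 <= s <= t ->
    is_derive s 1 (fun r : R => phi (p + r *: u)) (dphi (p + s *: u)).
  by move=> st; apply: line_is_derive; exact: d.
have [s||s st E] := @MVT R (fun r => phi (p + r *: u))
    (fun s => dphi (p + s *: u)) 0 t t0.
- by rewrite in_itv/= => /andP[s0 st]; apply: dl; rewrite !ltW.
- apply: derivable_within_continuous => s; rewrite in_itv/= => st.
  exact: (@ex_derive _ _ _ _ _ _ _ (dl s st)).
- exists s; first by move: st; rewrite in_itv/= => /andP[/ltW -> /ltW ->].
  by move: E; rewrite scale0r addr0 subr0 mulrC.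
Qed.

(** The mean value theorem is applied along [u] to the increment [phi (x + t *: w) - phi x], and
    then along [w] to [phi_u]. *)
Lemma second_difference_MVT phi phi_u phi_uw p u w (t : R) : 0 < t ->
  (forall a b, 0 <= a <= t -> 0 <= b <= t ->
    let x := p + a *: u + b *: w in
    is_derive x u phi (phi_u x) /\ is_derive x w phi_u (phi_uw x)) ->
  exists a b, [/\ 0 <= a <= t, 0 <= b <= t &
    phi (p + t *: u + t *: w) - phi (p + t *: u) - phi (p + t *: w) + phi p
    = t * (t * phi_uw (p + a *: u + b *: w))].
Proof.
move=> t0 d; have t00 : 0 <= (0 : R) <= t by rewrite lexx ltW.
have tt : 0 <= t <= t by rewrite lexx ltW.
pose h x := phi (x + t *: w) - phi x.
have dh a : 0 <= a <= t -> is_derive (p + a *: u) u h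
    (phi_u (p + a *: u + t *: w) - phi_u (p + a *: u)).
  move=> at_; have [d1 _] := d a 0 at_ t00; have [d2 _] := d a t at_ tt.
  rewrite scale0r addr0 in d1.
  exact: is_deriveB (translate_is_derive d2) d1.
have [a at_ Ea] := @line_MVT h (fun x => phi_u (x + t *: w) - phi_u x) p u t t0 dh.
rewrite /= in Ea.
have [b bt Eb] := @line_MVT phi_u phi_uw (p + a *: u) w t t0
  (fun b bt => (d a b at_ bt).2).
exists a, b; split; [exact: at_|exact: bt|].
rewrite -Eb -Ea /h; ring.
Qed.

(** The second difference is symmetric in [u] and [w], so in every small parallelogram a value of
    [phi_uw] equals a value of [phi_wu], possibly at another point; continuity at [p] removes the
    discrepancy. *)
Theorem mixed_derivatives_eq phi phi_u phi_w phi_uw phi_wu (U : set V) p u w :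
  open_nbhs p U ->
  (forall x, U x -> is_derive x u phi (phi_u x)) ->
  (forall x, U x -> is_derive x w phi (phi_w x)) ->
  (forall x, U x -> is_derive x w phi_u (phi_uw x)) ->
  (forall x, U x -> is_derive x u phi_w (phi_wu x)) ->
  {for p, continuous phi_uw} -> {for p, continuous phi_wu} ->
  phi_uw p = phi_wu p.
Proof.
move=> [oU Up] du dw duw dwu c1 c2; apply/eqP; apply: contraT => ne.
pose e := `|phi_uw p - phi_wu p| / 2.
have e0 : 0 < e by rewrite divr_gt0// normr_gt0 subr_eq0.
have [r r0 rP] : exists2 r : R, 0 < r & forall x, `|x - p| < r ->
    [/\ U x, `|phi_uw x - phi_uw p| < e & `|phi_wu x - phi_wu p| < e].
  have N : \forall x \near p,
      [/\ U x, `|phi_uw x - phi_uw p| < e & `|phi_wu x - phi_wu p| < e].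
    have n1 : \forall x \near p, `|phi_uw x - phi_uw p| < e.
      by move/cvgrPdistC_lt : c1 => /(_ e e0).
    have n2 : \forall x \near p, `|phi_wu x - phi_wu p| < e.
      by move/cvgrPdistC_lt : c2 => /(_ e e0).
    have n3 : \forall x \near p, U x := open_nbhs_nbhs (conj oU Up).
    apply: filterS3 n3 n1 n2 => x x1 x2 x3.
    by split; [exact: x1|exact: x2|exact: x3].
  move/nbhs_ballP : N => [r /= r0 rP]; exists r => // x xp.
  by apply: rP; rewrite -ball_normE /= distrC.
(* Sides of this size keep the whole parallelogram within distance [r / 2] of [p]. *)
pose t := r / (2 * (`|u| + `|w| + 1)).
have k0 : 0 < `|u| + `|w| + 1 by rewrite ltr_wpDl// addr_ge0.
have t0 : 0 < t by rewrite divr_gt0// mulr_gt0.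
have ball_t a b : 0 <= a <= t -> 0 <= b <= t -> `|p + a *: u + b *: w - p| < r.
  move=> /andP[a0 at_] /andP[b0 bt].
  have -> : p + a *: u + b *: w - p = a *: u + b *: w.
    by rewrite addrC -addrA addKr.
  apply: (le_lt_trans (ler_normD _ _)); rewrite !normrZ !ger0_norm//.
  apply: (@le_lt_trans _ _ (t * (`|u| + `|w| + 1))).
    rewrite !mulrDr mulr1 -[leLHS]addr0; apply: lerD; last exact: ltW.
    by apply: lerD; exact: ler_wpM2r.
  rewrite /t invfM mulrA -mulrA mulVf ?gt_eqF// mulr1.
  by rewrite ltr_pdivrMr// ltr_pMr// ltr1n.
have ball_t' b a : 0 <= b <= t -> 0 <= a <= t ->
    `|p + b *: w + a *: u - p| < r.
  by move=> ? ?; rewrite (addrAC p); exact: ball_t.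
have [a [b [at_ bt E1]]] : exists a b, [/\ 0 <= a <= t, 0 <= b <= t &
    phi (p + t *: u + t *: w) - phi (p + t *: u) - phi (p + t *: w) + phi p
    = t * (t * phi_uw (p + a *: u + b *: w))].
  apply: second_difference_MVT t0 _ => a b at_ bt.
  have [Ux _ _] := rP _ (ball_t a b at_ bt).
  split; [exact: du _ Ux|exact: duw _ Ux].
have [b' [a' [bt' at' E2]]] : exists b a, [/\ 0 <= b <= t, 0 <= a <= t &
    phi (p + t *: w + t *: u) - phi (p + t *: w) - phi (p + t *: u) + phi p
    = t * (t * phi_wu (p + b *: w + a *: u))].
  apply: second_difference_MVT t0 _ => b' a' bt' at'.
  have [Ux _ _] := rP _ (ball_t' b' a' bt' at').
  split; [exact: dw _ Ux|exact: dwu _ Ux].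
have E : phi_uw (p + a *: u + b *: w) = phi_wu (p + b' *: w + a' *: u).
  apply: (mulfI (lt0r_neq0 t0)); apply: (mulfI (lt0r_neq0 t0)).
  have swap (x y z v : R) : x - y - z + v = x - z - y + v by ring.
  by rewrite -[LHS]E1 (addrAC p) swap; exact: E2.
have [_ n1 _] := rP _ (ball_t a b at_ bt).
have [_ _ n2] := rP _ (ball_t' b' a' bt' at').
have : `|phi_uw p - phi_wu p| < e + e.
  have cancel (x y z : R) : x - y = (z - y) - (z - x) by ring.
  rewrite (cancel (phi_uw p) (phi_wu p) (phi_wu (p + b' *: w + a' *: u))) -{2}E.
  apply: (le_lt_trans (ler_normB _ _)); exact: ltrD n2 n1.
by rewrite /e -splitr ltxx.
Qed.

End SecondDerivative.

(** * Calculus of symmetric bilinear forms *)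

Section SymmetricForm.
Variables (R : realType) (V : lmodType R) (l : {symmetric V}).
Implicit Types (u v w : V) (k : R).

Lemma sformC u v : l u v = l v u.
Proof. by have := hermC l u v; rewrite /= expr0 mul1r. Qed.

Lemma sformDl u v w : l (u + v) w = l u w + l v w.
Proof. exact: linearDl. Qed.

Lemma sformDr u v w : l w (u + v) = l w u + l w v.
Proof. exact: linearDr. Qed.

Lemma sformZl k u w : l (k *: u) w = k * l u w.
Proof. exact: linearZl_LR. Qed.

Lemma sformZr k u w : l w (k *: u) = k * l w u.
Proof. exact: linearZr_LR. Qed.

Lemma sformNl u w : l (- u) w = - l u w.
Proof. exact: linearNl. Qed.

Lemma sformNr u w : l w (- u) = - l w u.
Proof. exact: linearNr. Qed.

Lemma sform0l w : l 0 w = 0.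
Proof. exact: linear0l. Qed.

Lemma sform0r w : l w 0 = 0.
Proof. exact: linear0r. Qed.

Lemma sform_suml I (r : seq I) (F : I -> V) w :
  l (\sum_(i <- r) F i) w = \sum_(i <- r) l (F i) w.
Proof.
by elim/big_rec2: _ => [|i x y _ <-]; rewrite ?sform0l// sformDl.
Qed.

Lemma sform_sumr I (r : seq I) (F : I -> V) w :
  l w (\sum_(i <- r) F i) = \sum_(i <- r) l w (F i).
Proof. by rewrite sformC sform_suml; apply: eq_bigr => i _; rewrite sformC. Qed.

Definition sformE := (sformDl, sformDr, sformZl, sformZr, sformNl, sformNr).

Definition nondegenerate_form := forall u, (forall v, l u v = 0) -> u = 0.

End SymmetricForm.

(** * Vanishing of the second derivatives of an isometry *)

Section DifferentialIsometry.
Variables (R : realType) (n : nat).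
Local Notation V := 'rV[R]_n.
Implicit Types (l : {symmetric V}) (F G : V -> V) (x u v w : V).

Lemma coord_is_derive F x v dF (i : 'I_n) : is_derive x v F dF ->
  is_derive x v (fun y => F y 0 i : R) (dF 0 i).
Proof.
case=> c E; have /cvg_ex[d cd] := c.
have Ed : d = dF by rewrite -E; apply/esym/cvg_lim.
rewrite {}Ed in cd.
have C : (fun h : R => h^-1 *: (((fun y => F y 0 i) \o shift x) (h *: v) - F x 0 i))
    @ 0^' --> (dF 0 i : R).
  have -> : (fun h : R => h^-1 *: (((fun y => F y 0 i) \o shift x) (h *: v) - F x 0 i))
      = (fun M : V => M 0 i) \o
        (fun h : R => h^-1 *: ((F \o shift x) (h *: v) - F x)).
    by apply/funext => h /=; rewrite !mxE.
  exact: cvg_comp cd (@coord_continuous R 1 n 0 i dF).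
apply: DeriveDef; last exact: cvg_lim C.
by apply/cvg_ex; exists (dF 0 i).
Qed.

Lemma sform_coord l u v :
  l u v = \sum_(i < n) \sum_(j < n) l (delta_mx 0 i) (delta_mx 0 j) * (u 0 i * v 0 j).
Proof.
rewrite {1}(row_sum_delta u) sform_suml; apply: eq_bigr => i _.
rewrite {1}(row_sum_delta v) sform_sumr; apply: eq_bigr => j _.
by rewrite sformZl sformZr; ring.
Qed.

Lemma sform_is_derive l F G x v dF dG :
  is_derive x v F dF -> is_derive x v G dG ->
  is_derive x v (fun y => l (F y) (G y) : R) (l dF (G x) + l (F x) dG).
Proof.
move=> hF hG.
have -> : (fun y => l (F y) (G y)) = \sum_(i < n) \sum_(j < n)
    (l (delta_mx 0 i) (delta_mx 0 j) *: ((fun y => F y 0 i : R) * (fun y => G y 0 j : R))).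
  apply/funext => y; rewrite sform_coord fct_sumE; apply: eq_bigr => i _.
  by rewrite fct_sumE; apply: eq_bigr => j _.
have -> : l dF (G x) + l (F x) dG = \sum_(i < n) \sum_(j < n)
    (l (delta_mx 0 i) (delta_mx 0 j) *: (F x 0 i *: dG 0 j + G x 0 j *: dF 0 i)).
  rewrite (sform_coord l dF) (sform_coord l (F x)) -big_split; apply: eq_bigr => i _.
  rewrite /= -big_split; apply: eq_bigr => j _ /=.
  by rewrite -mulrDr /GRing.scale/=; congr (_ * _); ring.
apply: is_derive_sum => i; apply: is_derive_sum => j; apply: is_deriveZ.
by apply: is_deriveM; exact: coord_is_derive.
Qed.

(** Alternating the two transpositions, three times each, returns to the initial order of the
    arguments; the three skew swaps leave a minus sign. *)
Lemma skew_symmetric_tensor0 (I : Type) (T : I -> I -> I -> R) :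
  (forall a b c, T a b c = - T c b a) -> (forall a b c, T a b c = T b a c) ->
  forall a b c, T a b c = 0.
Proof.
move=> skT symT a b c; have : T a b c = - T a b c.
  by rewrite [LHS]skT [in LHS]symT [in LHS]skT opprK [LHS]symT [LHS]skT [in LHS]symT.
by move/eqP; rewrite -addr_eq0 -mulr2n mulrn_eq0/= => /eqP.
Qed.

(** The tensor [l' (D2 a b p) (D1 c p)] is skew by differentiation of the isometry identity and
    symmetric by [mixed_derivatives_eq]. The matrix [J] records that [D1 v p] is linear in [v]. *)
Lemma isometry_hessian_eq0 l l' (U : set V) F (D1 : V -> V -> V)
    (D2 : V -> V -> V -> V) p : open_nbhs p U ->
  nondegenerate_form l -> nondegenerate_form l' ->
  (forall x v, U x -> is_derive x v F (D1 v x)) ->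
  (forall x v w, U x -> is_derive x w (D1 v) (D2 v w x)) ->
  (forall v w, {for p, continuous (D2 v w)}) ->
  (exists J : 'M[R]_n, forall v, D1 v p = v *m J) ->
  (forall x, U x -> forall v w, l' (D1 v x) (D1 w x) = l v w) ->
  forall u w, D2 u w p = 0.
Proof.
move=> [oU Up] nd nd' hD1 hD2 cD2 [J D1J] isoD u w.
have skew v z y : l' (D2 v y p) (D1 z p) = - l' (D1 v p) (D2 z y p).
  have h1 := sform_is_derive l' (hD2 p v y Up) (hD2 p z y Up).
  have h2 : is_derive p y (fun x => l' (D1 v x) (D1 z x) : R) 0.
    apply: (@near_eq_is_derive _ _ _ (cst (l v z : R))).
      have n3 : \forall x \near p, U x := open_nbhs_nbhs (conj oU Up).
      by apply: filterS n3 => x Ux; rewrite isoD.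
  have /eqP := etrans (esym (@derive_val _ _ _ _ _ _ _ h1)) (@derive_val _ _ _ _ _ _ _ h2).
  by rewrite addr_eq0 => /eqP.
have sym v z : D2 v z p = D2 z v p.
  apply/rowP => i.
  apply: (@mixed_derivatives_eq R V (fun y => F y 0 i) (fun y => D1 v y 0 i)
    (fun y => D1 z y 0 i) (fun y => D2 v z y 0 i) (fun y => D2 z v y 0 i) U p v z).
  - exact: conj oU Up.
  - by move=> x Ux; apply: coord_is_derive; exact: hD1.
  - by move=> x Ux; apply: coord_is_derive; exact: hD1.
  - by move=> x Ux; apply: coord_is_derive; exact: hD2.
  - by move=> x Ux; apply: coord_is_derive; exact: hD2.
  - exact: cvg_comp (cD2 v z) (@coord_continuous R 1 n 0 i _).
  - exact: cvg_comp (cD2 z v) (@coord_continuous R 1 n 0 i _).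
have T0 v : l' (D2 u w p) (D1 v p) = 0.
  pose T a b c := l' (D2 a b p) (D1 c p).
  apply: (@skew_symmetric_tensor0 _ T) => a b c; rewrite /T; last by rewrite sym.
  by rewrite skew sformC.
(* An isometric linear map is injective because [l] is nondegenerate, hence onto in equal
   dimensions. *)
have Jsurj y : exists v, y = D1 v p.
  have Ju : J \in unitmx.
    rewrite -row_free_unit -kermx_eq0; apply/eqP/row_matrixP => i; rewrite row0.
    apply: nd => z; rewrite -(isoD p Up) D1J -row_mul mulmx_ker row0.
    exact: sform0l.
  by exists (y *m invmx J); rewrite D1J mulmxKV.
by apply: nd' => y; have [v ->] := Jsurj y; exact: T0.
Qed.

Lemma smooth_isometry_hessian_eq0 l l' (U : set V) F p u w :
  nondegenerate_form l -> nondegenerate_form l' -> open U -> U p -> smooth_on U F ->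
  (forall x, U x -> forall u v, l' ('d F x u) ('d F x v) = l u v) ->
  is_derive p w (fun x => 'D_u F x) 0.
Proof.
move=> nd nd' oU Up smF isoF; have [dF dF1] := smF 2%N.
have hD1 x v : U x -> is_derive x v F ('D_v F x).
  by move=> Ux; apply/derivableP/diff_derivable; exact: dF.
have hD2 x v z : U x -> is_derive x z (fun y => 'D_v F y) ('D_z (fun y => 'D_v F y) x).
  move=> Ux; apply/derivableP/diff_derivable.
  by have [dd _] := dF1 v; exact: dd.
rewrite -(@isometry_hessian_eq0 l l' U F (fun v x => 'D_v F x)
  (fun v w x => 'D_w (fun y => 'D_v F y) x) p _ nd nd' hD1 hD2 _ _ _ u w).
- exact: hD2.
- exact: conj oU Up.
- by move=> v z; have [_ cc] := dF1 v; exact: cc.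
- by exists (jacobian F p) => v; apply: deriveEjacobian; exact: dF.
- by move=> x Ux v z; rewrite !deriveE; [exact: isoF|exact: dF|exact: dF].
Qed.

End DifferentialIsometry.

(** * Smooth isometries are locally affine *)

Section LocallyAffine.
Variables (R : realType) (n : nat).
Local Notation V := 'rV[R]_n.

(** The mean value theorem is used one coordinate at a time, so the intermediate point depends on
    [i]; this is harmless where the derivative is constant. *)
Lemma is_derive_ball (F : V -> V) (dF : V -> V) (p x : V) (r : R) :
  `|x - p| < r ->
  (forall y, `|y - p| < r -> is_derive y (x - p) F (dF y)) ->
  forall i, exists2 y, `|y - p| < r & F x 0 i - F p 0 i = dF y 0 i.
Proof.
move=> xr d i.
have inball s : 0 <= s <= 1 -> `|p + s *: (x - p) - p| < r.
  move=> /andP[s0 s1]; rewrite addrC addKr normrZ ger0_norm//.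
  by apply: (le_lt_trans _ xr); exact: ler_piMl.
have [|s s01] := @line_MVT R V (fun y => F y 0 i) (fun y => dF y 0 i) p (x - p) 1 ltr01.
  by move=> s s01; apply: coord_is_derive; apply: d; exact: inball.
rewrite scale1r mul1r (addrC p) subrK => E.
by exists (p + s *: (x - p)); first exact: inball.
Qed.

(** [is_derive_ball] serves twice: for ['D_u F], whose derivative vanishes, so that it is constant
    on a ball, and then for [F] itself. *)
Lemma smooth_isometry_locally_affine (l l' : {symmetric V}) (U : set V)
    (F : V -> V) (p : V) :
  nondegenerate_form l -> nondegenerate_form l' -> open_nbhs p U -> smooth_on U F ->
  (forall x, U x -> forall u v, l' ('d F x u) ('d F x v) = l u v) ->
  exists (J : 'M[R]_n) (t : V),
    (forall u v, l' (u *m J) (v *m J) = l u v) /\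
    \forall x \near p, F x = x *m J + t.
Proof.
move=> nd nd' [oU Up] smF isoF.
have [dF _] := smF 1%N.
have [r r0 rU] : exists2 r : R, 0 < r & forall x, `|x - p| < r -> U x.
  have /nbhs_ballP[r /= r0 rP] := open_nbhs_nbhs (conj oU Up).
  by exists r => // x xp; apply: rP; rewrite -ball_normE /= distrC.
pose J := jacobian F p.
have DJ v : 'D_v F p = v *m J by apply: deriveEjacobian; exact: dF.
have Dcst u x : `|x - p| < r -> 'D_u F x = u *m J.
  move=> xr; rewrite -DJ; apply/rowP => i; apply/eqP; rewrite -subr_eq0; apply/eqP.
  have [y yr ->] := @is_derive_ball (fun y => 'D_u F y) (fun=> 0) p x r xr
    (fun y yr => smooth_isometry_hessian_eq0 u (x - p) nd nd' oU (rU y yr) smF isoF) i.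
  by rewrite mxE.
exists J, (F p - p *m J); split.
  by move=> u v; rewrite -!DJ !deriveE; [exact: isoF|exact: dF|exact: dF].
apply/nbhs_ballP; exists r => // x; rewrite -ball_normE /= distrC => xr.
have dFx y : `|y - p| < r -> is_derive y (x - p) F ('D_(x - p) F y).
  by move=> yr; apply/derivableP/diff_derivable; apply: dF; exact: rU.
apply/rowP => i; have [y yr] := is_derive_ball xr dFx i.
rewrite Dcst// => /eqP; rewrite subr_eq => /eqP ->.
by rewrite mulmxBl !mxE; ring.
Qed.

End LocallyAffine.

(** * Continuity of linear maps and quadratic forms *)

Section FiniteDimensionalContinuity.
Variables (R : realType) (n : nat).
Local Notation V := 'rV[R]_n.

Lemma linear_rV_continuous (W : normedModType R) (f : {linear V -> W}) :
  continuous f.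
Proof.
move=> x; apply: differentiable_continuous.
have -> : (f : V -> W) =
    \sum_(i < n) (fun v : V => (v 0 i : R) *: f (delta_mx 0 i)).
  apply/funext => v; rewrite {1}(row_sum_delta v) linear_sum fct_sumE.
  by apply: eq_bigr => i _; rewrite linearZ.
apply: differentiable_sum => i; apply: differentiableZl.
exact: differentiable_coord.
Qed.

Lemma sform_continuous (l : {symmetric V}) : continuous (fun v => l v v : R).
Proof.
move=> x; apply: differentiable_continuous.
have -> : (fun v => l v v : R) = \sum_(i < n) \sum_(j < n)
    (l (delta_mx 0 i) (delta_mx 0 j) *:
      ((fun v : V => v 0 i : R) * (fun v : V => v 0 j : R))).
  apply/funext => v; rewrite sform_coord fct_sumE; apply: eq_bigr => i _.
  by rewrite fct_sumE; apply: eq_bigr => j _.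
apply: differentiable_sum => i; apply: differentiable_sum => j.
apply: differentiableZ; apply: differentiableM; exact: differentiable_coord.
Qed.

End FiniteDimensionalContinuity.

(** * Lorentzian forms and causal cones *)

Section Lorentzian.
Variables (R : realType) (n : nat) (l : {symmetric 'rV[R]_n}).
Hypothesis lor : lorentzian l.
Local Notation V := 'rV[R]_n.

Lemma lorentzian_nondegenerate : nondegenerate_form l.
Proof.
move=> u hu; have [P Pu Pl] := lor.
have cE : u = (u *m invmx P) *m P by rewrite mulmxKV.
suff c0 : u *m invmx P = 0 by rewrite cE c0 mul0mx.
apply/rowP => j; rewrite [RHS]mxE.
have := hu (row j P); rewrite {1}cE mulmx_sum_row sform_suml (bigD1 j)//=.
rewrite big1 => [|i ij]; last by rewrite sformZl Pl (negbTE ij) mulr0.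
rewrite sformZl Pl eqxx addr0 => /eqP; rewrite mulf_eq0 => /orP[/eqP //|].
by case: ifP => _; rewrite ?oppr_eq0 oner_eq0.
Qed.

(** The column [c] reads off the time coordinate in the basis formed by the rows of [P]; where it
    vanishes, only negative squares remain. *)
Lemma lorentzian_time_coordinate : (0 < n)%N -> exists c : 'cV[R]_n,
  forall w, (w *m c) 0 0 = 0 -> w != 0 -> l w w < 0.
Proof.
move=> n0; have [P Pu Pl] := lor; pose i0 := Ordinal n0.
exists (col i0 (invmx P)) => w; rewrite colE mulmxA -colE mxE.
set y := w *m invmx P => y0 wn0.
have wE : w = \sum_i y 0 i *: row i P by rewrite -mulmx_sum_row mulmxKV.
have lwE : l w w = - \sum_(i | i != i0) y 0 i ^+ 2.
  rewrite {1}wE sform_suml (bigD1 i0)//= sformZl y0 mul0r add0r -sumrN.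
  apply: eq_bigr => i ii0; rewrite sformZl wE sform_sumr (bigD1 i)//= big1.
    rewrite sformZr Pl eqxx ifF ?addr0; last exact: negbTE.
    by rewrite mulrN1 mulrN expr2.
  by move=> j ji; rewrite sformZr Pl eq_sym (negbTE ji) mulr0.
rewrite lwE oppr_lt0 lt0r sumr_ge0 ?andbT; last by move=> i _; exact: sqr_ge0.
apply: contra_neq wn0 => s0; rewrite wE big1// => i _.
have [->|ii0] := eqVneq i i0; first by rewrite y0 scale0r.
have /eqP := @psumr_eq0P _ _ _ _ (fun i _ => sqr_ge0 (y 0 i)) s0 i ii0.
by rewrite sqrf_eq0 => /eqP ->; rewrite scale0r.
Qed.

Lemma lorentzian_orthogonal_lt0 v u :
  0 < l v v -> l v u = 0 -> u != 0 -> l u u < 0.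
Proof.
move=> v0 vu un0; have [n0|/prednK n0] := posnP n.
  by case/eqP: un0; apply/rowP; case=> i ilt; have := ilt; rewrite {1}n0.
have [|c cP] := lorentzian_time_coordinate; first by rewrite -n0.
have [u0|u0] := eqVneq ((u *m c) 0 0) 0; first exact: cP.
(* This combination has no time coordinate, so [l w w <= 0]; were [l u u] nonnegative, the cross
   term being zero, [l w w] would be positive. *)
pose w := (u *m c) 0 0 *: v - (v *m c) 0 0 *: u.
have cw : (w *m c) 0 0 = 0.
  by rewrite mulmxBl -!scalemxAl !mxE mulrC subrr.
have lw : l w w = (u *m c) 0 0 ^+ 2 * l v v + (v *m c) 0 0 ^+ 2 * l u u.
  by rewrite /w !sformE (sformC l u v) vu; ring.
have p1 : 0 < (u *m c) 0 0 ^+ 2 * l v v by rewrite mulr_gt0// exprn_even_gt0.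
have lw0 : l w w <= 0.
  have [->|wn0] := eqVneq w 0; first by rewrite sform0l.
  exact/ltW/cP.
rewrite ltNge; apply/negP => u1.
have p2 : 0 <= (v *m c) 0 0 ^+ 2 * l u u by rewrite mulr_ge0// sqr_ge0.
by move: lw0; rewrite lw leNgt ltr_pwDl.
Qed.

(** The sum [v0 + v1] is timelike, of square 2, and orthogonal to [u]. *)
Lemma lorentzian_hyperbolic_orthogonal_lt0 v0 v1 u :
  l v0 v0 = 0 -> l v1 v1 = 0 -> l v0 v1 = 1 ->
  l v0 u = 0 -> l v1 u = 0 -> u != 0 -> l u u < 0.
Proof.
move=> h0 h1 h01 u0 u1; apply: (@lorentzian_orthogonal_lt0 (v0 + v1)).
  by rewrite !sformE h0 h1 h01 (sformC l v1) h01 add0r addr0 addr_gt0.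
by rewrite !sformE u0 u1 addr0.
Qed.

Lemma lorentzian_orthogonal_exists v : (1 < n)%N -> 
  exists2 u, u != 0 & l v u = 0.
Proof.
move=> n1; pose A : 'M[R]_(n, 1) := \col_i l v (delta_mx 0 i).
have AE u : (u *m A) 0 0 = l v u.
  rewrite mxE {2}(row_sum_delta u) sform_sumr; apply: eq_bigr => i _.
  by rewrite mxE sformZr.
have : kermx A != 0.
  rewrite kermx_eq0 -row_leq_rank -ltnNge.
  exact: leq_ltn_trans (rank_leq_col A) n1.
case/rowV0Pn => u /sub_kermxP uA un0.
by exists u; [exact: un0|rewrite -AE uA mxE].
Qed.

(** Take [w] spacelike, orthogonal to [v], and so short that [v + w] and [- v + w] are timelike. If
    [K] contained both [v] and [- v], neither sum could lie in [K], since adding [- v] or [v] would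
    put [w] there. Both would lie in [K'], and so would their spacelike sum [2 *: w]. *)
Lemma cone_no_line (K K' : set V) v : (1 < n)%N ->
  closed_convex_cone K -> closed_convex_cone K' ->
  K `|` K' = [set v | 0 <= l v v] -> 0 < l v v -> K v -> ~ K (- v).
Proof.
move=> n1 [_ cK sK] [_ cK' sK'] KK' v0.
have [u un0 vu] := lorentzian_orthogonal_exists v n1.
have u0 := lorentzian_orthogonal_lt0 v0 vu un0.
have cone_add (S : set V) : convex_set S ->
    (forall (t : R) (v : V), 0 <= t -> S v -> S (t *: v)) ->
    forall x y, S x -> S y -> S (x + y).
  move=> cS sS x y Sx Sy.
  have h0 : 0 <= 2^-1 :> R by rewrite invr_ge0.
  have h1 : 2^-1 <= 1 :> R by rewrite invf_le1// ler1n.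
  have half : 1 - 2^-1 = 2^-1 :> R by field.
  have h : S ((2^-1 : R) *: x + (1 - 2^-1 : R) *: y).
    exact: set_mem (@cS x y (Itv01 h0 h1) (mem_set Sx) (mem_set Sy)).
  rewrite half in h.
  have := sS 2 _ ltac:(lra) h; rewrite scalerDr !scalerA divff ?pnatr_eq0//.
  by rewrite !scale1r.
have [w [w0 vw wv]] : exists w, [/\ l w w < 0, l v w = 0 & 0 < l v v + l w w].
  (* With this [t] in the open unit interval, [- t ^+ 2 * l u u = t * (1 - t) * l v v], which is
     less than [l v v]. *)
  pose t := l v v / (l v v - l u u).
  have d0 : 0 < l v v - l u u by rewrite subr_gt0 (lt_trans u0 v0).
  have t0 : 0 < t by rewrite divr_gt0.
  have t1 : t < 1 by rewrite ltr_pdivrMr// mul1r ltrDl oppr_gt0.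
  have td : t * (l v v - l u u) = l v v by rewrite divfK// gt_eqF.
  exists (t *: u); rewrite !sformE vu mulr0; split=> //.
    by rewrite !pmulr_rlt0.
  nra.
have KvK x : l x x < 0 -> ~ K x.
  move=> x0 Kx; have : [set v | 0 <= l v v] x by rewrite -KK'; left.
  by rewrite /= leNgt x0.
have KvK' x : l x x < 0 -> ~ K' x.
  move=> x0 Kx; have : [set v | 0 <= l v v] x by rewrite -KK'; right.
  by rewrite /= leNgt x0.
have K'w x : 0 <= l x x -> ~ K x -> K' x.
  by move=> x0 nKx; have : [set v | 0 <= l v v] x by []; rewrite -KK' => -[].
move=> Kv KNv.
have p1 : K' (v + w).
  apply: K'w; first by rewrite !sformE (sformC l w) vw add0r addr0 ltW.
  by move=> Kp; apply: (KvK w w0); rewrite -(addKr v w); exact: cone_add.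
have p2 : K' (- v + w).
  apply: K'w; first by rewrite !sformE (sformC l w) vw oppr0 add0r addr0 opprK ltW.
  by move=> Kp; apply: (KvK w w0); rewrite -(addNKr v w); exact: cone_add.
have := cone_add K' cK' sK' _ _ p1 p2.
have -> : v + w + (- v + w) = 2 *: w by rewrite addrACA subrr add0r scaler_nat mulr2n.
by apply: KvK'; rewrite !sformE !pmulr_rlt0.
Qed.

(** Near a timelike boundary point of [K] all points are timelike, and those outside [K] lie in
    [K']; hence [v] lies in both cones. As [- v] lies in one of them, that cone contains a line,
    against [cone_no_line]. *)
Lemma boundary_isotropic (K : set V) v : (1 < n)%N -> is_causal_cone l K ->
  boundary K v -> l v v = 0.
Proof.
move=> n1 [cK [K' cK' KK']] [clv niv].
have [[clK _ _] [clK' _ sK']] := (cK, cK').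
have Kv : K v by rewrite (closure_id K).1.
have : [set v | 0 <= l v v] v by rewrite -KK'; left.
rewrite /= le_eqVlt => /orP[/eqP //|v0]; exfalso.
have K'v : K' v.
  rewrite (closure_id K').1// => B nB; apply: contrapT => BK'; apply: niv.
  have np : \forall x \near v, 0 < l x x.
    have := @sform_continuous R n l v; move/(_ [set r | 0 < r]); apply.
    exact: lt_nbhsr.
  apply: filterS2 np (nB : \forall x \near v, B x) => x x0 Bx.
  have : [set v | 0 <= l v v] x by exact: ltW.
  by rewrite -KK' => -[//|K'x]; exfalso; apply: BK'; exists x.
have lN : 0 < l (- v) (- v) by rewrite !sformE opprK.
have : [set v | 0 <= l v v] (- v) by exact: ltW.
rewrite -KK' => -[KNv|K'Nv].
  exact: (cone_no_line n1 cK cK' KK' v0 Kv KNv).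
by apply: (cone_no_line n1 cK' cK _ v0 K'v K'Nv); rewrite setUC.
Qed.

End Lorentzian.

(** * Affine maps with isometric linear part *)

Section AffineIsometries.
Variables (R : realType) (n : nat).
Local Notation V := 'rV[R]_n.
Implicit Types (l : {symmetric V}) (G H : V -> V) (A B : 'M[R]_n).

Definition isometry_mx l l' A := forall u v, l' (u *m A) (v *m A) = l u v.

Definition affine_with G A := forall u v : V, G (u + v) = G u + v *m A.

Lemma affine_withB G A u v : affine_with G A -> G u - G v = (u - v) *m A.
Proof. by move=> aG; rewrite -{1}(subrK v u) (addrC _ v) aG addrC addKr. Qed.

Lemma isometry_mx_unit l l' A :
  nondegenerate_form l -> isometry_mx l l' A -> A \in unitmx.
Proof.
move=> nd isoA.
rewrite -row_free_unit -kermx_eq0; apply/eqP/row_matrixP => i; rewrite row0.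
apply: nd => z; rewrite -isoA -row_mul mulmx_ker row0.
exact: sform0l.
Qed.

Lemma isometry_mx_inv l l' A : A \in unitmx ->
  isometry_mx l l' A -> isometry_mx l' l (invmx A).
Proof. by move=> Au isoA u v; rewrite -isoA !mulmxKV. Qed.

Lemma isometry_mx_mul l1 l2 l3 A B :
  isometry_mx l1 l2 A -> isometry_mx l2 l3 B -> isometry_mx l1 l3 (A *m B).
Proof. by move=> isoA isoB u v; rewrite !mulmxA isoB isoA. Qed.

Lemma affine_with_comp G H A B :
  affine_with G A -> affine_with H B -> affine_with (H \o G) (A *m B).
Proof. by move=> aG aH u v; rewrite /= aG aH mulmxA. Qed.

End AffineIsometries.

(** * The unipotent action of the vector group [T] *)

Section UnipotentAction.
Variables (R : realType) (n : nat) (D : unipotent_data R n).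
Hypothesis n1 : (1 < n)%N.
Local Notation V := 'rV[R]_n.
Local Notation T := (subvs_of (Tsp D)).
Local Notation l := (lform D).
Local Notation v0 := (v0 D).
Local Notation v1 := (v1 D).
Local Notation a := (amap D).
Implicit Types (x y : T) (u v w : V).

Lemma v0_isotropic : l v0 v0 = 0.
Proof. exact (boundary_isotropic (lform_lorentzian D) n1 (coneP D) (v0_boundary D)). Qed.

Lemma v1_isotropic : l v1 v1 = 0.
Proof. exact (boundary_isotropic (lform_lorentzian D) n1 (coneP D) (v1_boundary D)). Qed.

Lemma v1_v0 : l v1 v0 = 1.
Proof. by rewrite sformC; exact: lform_v0_v1. Qed.

Lemma v0_T x : l v0 (vsval x) = 0.
Proof. by have [] := Tsp_sub_N x. Qed.

Lemma v0_amap x : l v0 (a x) = 0.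
Proof. by have [] := amap_sub_N x. Qed.

Lemma v1_T x : l v1 (vsval x) = 0.
Proof. by have [] := Tsp_sub_N x. Qed.

Lemma v1_amap x : l v1 (a x) = 0.
Proof. by have [] := amap_sub_N x. Qed.

Lemma T_v0 x : l (vsval x) v0 = 0.
Proof. by rewrite sformC v0_T. Qed.

Lemma amap_v0 x : l (a x) v0 = 0.
Proof. by rewrite sformC v0_amap. Qed.

Definition ortho_simpl :=
  (v0_isotropic, v1_isotropic, v1_v0, lform_v0_v1, v0_T, v0_amap, T_v0, amap_v0,
   v1_T, v1_amap).

Lemma N_anisotropic u : Nset l v0 v1 u -> l u u = 0 -> u = 0.
Proof.
move=> [u0 u1] luu; apply/eqP; apply: contraT => un0.
have := lorentzian_hyperbolic_orthogonal_lt0 (lform_lorentzian D)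
  v0_isotropic v1_isotropic (lform_v0_v1 D) u0 u1 un0.
by rewrite luu ltxx.
Qed.

(** Subtracting [l v1 u *: v0] from [u] leaves an isotropic vector of [N], which is zero because the
    form is definite there. *)
Lemma v0_orthogonal_orthogonal u :
  (forall w, l v0 w = 0 -> l u w = 0) -> u = l v1 u *: v0.
Proof.
move=> hu; have u0 : l v0 u = 0 by rewrite sformC hu// v0_isotropic.
pose w := u - l v1 u *: v0.
have w0 : l v0 w = 0 by rewrite !sformE u0 v0_isotropic; ring.
have w1 : l v1 w = 0 by rewrite !sformE v1_v0; ring.
have : w = 0.
  apply: N_anisotropic; first by [].
  by rewrite {1}/w sformDl sformNl sformZl hu// w0 mulr0 subr0.
by move/eqP; rewrite subr_eq0 => /eqP.
Qed.

(** The images of [v1] differ by a multiple [c] of [v0 *m A], since the difference is orthogonal to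
    the image of the hyperplane. The image of [v1] under [B] is isotropic, which gives
    [2 * c = 0]. *)
Lemma isometry_mx_eq A B : isometry_mx l l A -> isometry_mx l l B ->
  (forall w, l v0 w = 0 -> w *m A = w *m B) -> forall v : V, v *m A = v *m B.
Proof.
move=> isoA isoB AB.
have Au := isometry_mx_unit (lorentzian_nondegenerate (lform_lorentzian D)) isoA.
suff AB1 : v1 *m A = v1 *m B.
  move=> v; have -> : v = (v - l v0 v *: v1) + l v0 v *: v1 by rewrite subrK.
  rewrite !(mulmxDl (v - _)) -!scalemxAl AB1 AB// !sformE lform_v0_v1; ring.
pose u := (v1 *m B - v1 *m A) *m invmx A.
have uA : v1 *m B = v1 *m A + u *m A by rewrite mulmxKV// addrC subrK.
have uE : u = l v1 u *: v0.
  apply: v0_orthogonal_orthogonal => w w0.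
  by rewrite -isoA mulmxKV// !sformE isoA {1}(AB _ w0) isoB subrr.
have : l (v1 *m B) (v1 *m B) = 0 by rewrite isoB v1_isotropic.
rewrite uA uE -scalemxAl !sformE !isoA !ortho_simpl !mulr0 !addr0 add0r mulr1 => /eqP.
rewrite -mulr2n mulrn_eq0/= => /eqP u0.
by rewrite u0 scale0r addr0.
Qed.

Lemma gammaE x v : gamma x v = v + (l v0 v *: a x + vsval x)
   - (l (a x) v + 2^-1 * l v0 v * l (a x) (a x) + 2^-1 * l (a x) (vsval x)) *: v0.
Proof. by rewrite /gamma /lambda /tau /l0; apply/rowP => i; rewrite !mxE; ring. Qed.

Lemma v0_gamma x v : l v0 (gamma x v) = l v0 v.
Proof. by rewrite gammaE !sformE !ortho_simpl; ring. Qed.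

Lemma gammaD x y v : gamma (x + y) v = gamma x (gamma y v).
Proof.
rewrite [in RHS](gammaE x) v0_gamma !gammaE !linearD/= !sformE !ortho_simpl.
rewrite (sformC l (a y) (vsval x)) -(amap_sym x y) (sformC l (a y) (a x)).
by apply/rowP => i; rewrite !mxE; field.
Qed.

Lemma gamma0 v : gamma (0 : T) v = v.
Proof.
rewrite gammaE !linear0 !sform0l.
by apply/rowP => i; rewrite !mxE; ring.
Qed.

Lemma gamma_affine x : exists A, isometry_mx l l A /\ affine_with (gamma x) A.
Proof.
have lin : linear (lambda x).
  move=> k u v; rewrite /lambda /l0 !sformE; apply/rowP => i; rewrite !mxE; ring.
pose f : {linear V -> V} := HB.pack (lambda x) (GRing.isLinear.Build _ _ _ _ _ lin).
exists (lin1_mx f); split=> u v; rewrite !mul_rV_lin1 /=.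
  by rewrite /lambda /l0 !sformE !ortho_simpl (sformC l u v0) (sformC l u (a x)); field.
rewrite -[LHS]/(f (u + v) + tau x) -[RHS]/(f u + tau x + f v).
by rewrite linearD addrAC.
Qed.

(* The projection of [v0^perp] onto [N] along [v0]. *)
Definition Nproj v := v - l v1 v *: v0.

Lemma Nproj_v0 k : Nproj (k *: v0) = 0.
Proof. by rewrite /Nproj sformZr v1_v0 mulr1 subrr. Qed.

Lemma Nproj_sform u : l v0 u = 0 -> l (Nproj u) (Nproj u) = l u u.
Proof. by move=> u0; rewrite /Nproj !sformE (sformC l u v0) u0 v0_isotropic; ring. Qed.

Lemma Nproj_linear : linear Nproj.
Proof. by move=> k u v; rewrite /Nproj !sformE; apply/rowP => i; rewrite !mxE; ring. Qed.

(** This links the action to [qform]: modulo [v0], the displacement of [v] is [(1 + s a) x] with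
    [s = l v0 v]. *)
Lemma Nproj_gamma x v : Nproj (gamma x v - v) = vsval x + l v0 v *: a x.
Proof.
by rewrite gammaE /Nproj !sformE !ortho_simpl; apply/rowP => i; rewrite !mxE; ring.
Qed.

End UnipotentAction.

(** * Lattice orbits and the isometries that preserve them *)

Section Orbits.
Variables (R : realType) (n : nat) (M : unipotent_manifold R n).
Hypothesis n1 : (1 < n)%N.
Local Notation V := 'rV[R]_n.
Local Notation D := (udata M).
Local Notation T := (subvs_of (Tsp D)).
Local Notation l := (lform D).
Local Notation a := (amap D).
Implicit Types (x y g : T) (u v w : V).

Lemma lattice_opp g : lattice M g -> lattice M (- g).
Proof.
have [G0 GB _ _] := latticeP M.
by move=> Gg; rewrite -sub0r; exact: GB.
Qed.

Lemma lattice_add g h : lattice M g -> lattice M h -> lattice M (g + h).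
Proof.
have [_ GB _ _] := latticeP M.
by move=> Gg Gh; rewrite -(opprK h); apply: GB => //; exact: lattice_opp.
Qed.

Lemma proj_eqP v w :
  proj M v = proj M w <-> exists2 g, lattice M g & gamma g v = w.
Proof.
split=> [E|[g Gg <-]].
  have : proj M w w by exists 0; [have [] := latticeP M|exact: gamma0].
  by rewrite -E => -[g Gg gE]; exists g.
apply/seteqP; split=> _ [h Gh <-].
  exists (h - g); first by apply: lattice_add => //; exact: lattice_opp.
  by rewrite -gammaD// subrK.
by exists (h + g); [exact: lattice_add|rewrite gammaD].
Qed.

(** Injectivity of [1 + s a] provides a linear left inverse, by which a group element is recovered
    from the displacement of a point. *)
Lemma one_plus_amap_inverse (s : R) :
  exists K : 'Hom(V, T), forall x, K (vsval x + s *: a x) = x.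
Proof.
have lin : linear (fun x : T => vsval x + s *: a x).
  move=> k x y; rewrite !linearP scalerDr !scalerA mulrC -!scalerA; exact: addrACA.
pose f : {linear T -> V} := HB.pack (fun x : T => vsval x + s *: a x)
  (GRing.isLinear.Build _ _ _ _ _ lin).
have k0 : lker (linfun f) == 0%VS.
  apply/lker0P => x y; rewrite !lfunE => /eqP; rewrite -subr_eq0 -linearB => /eqP /amap_ker.
  by move/eqP; rewrite subr_eq0 => /eqP.
exists ((linfun f)^-1)%VF => x.
by have := lker0_lfunK k0 x; rewrite [linfun f x]lfunE.
Qed.

Lemma nbhs_radius (W : normedModType R) (p : W) (P : set W) :
  (\forall x \near p, P x) -> exists2 r : R, 0 < r & forall z : W, `|z| < r -> P (p + z).
Proof.
move=> /nbhs_ballP[r /= r0 rP]; exists r => // z zr.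
by apply: rP; rewrite -ball_normE /= opprD addNKr normrN.
Qed.

Lemma scaled_small w (r : R) : 0 < r -> exists2 k : R, k != 0 & `|k *: w| < r.
Proof.
move=> r0; pose k := r / (`|w| + 1).
have w0 : 0 < `|w| + 1 by rewrite ltr_wpDl.
have k0 : 0 < k by rewrite divr_gt0.
exists k; first by rewrite gt_eqF.
rewrite normrZ gtr0_norm// /k -mulrA gtr_pMr// mulrC ltr_pdivrMr// mul1r.
by rewrite ltrDl.
Qed.

(* Moving the base point by [w] orthogonal to [v0] keeps [1 + s a] fixed, so the
   group element carrying [y0 + w] to [G (y0 + w)] depends affinely on [w];
   being in a discrete group it is constant. *)
Lemma affine_isometry_preserving_orbits (G : V -> V) A (y0 : V) :
  isometry_mx l l A -> affine_with G A ->
  (\forall v \near y0, exists2 g, lattice M g & gamma g v = G v) ->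
  exists2 g, lattice M g & forall v, G v = gamma g v.
Proof.
move=> isoA affA nearG.
have [g0 Gg0 g0E] := nbhs_singleton nearG.
have [r r0 rG] := nbhs_radius nearG.
pose s := l (v0 D) y0.
have [K KE] := one_plus_amap_inverse s.
(* [L w] is the change of the group element, recovered through [K], when the base point moves from
   [y0] to [y0 + w]. *)
pose L w : V := vsval (K (Nproj D (w *m A - w))).
have linL : linear L.
  move=> k u v; rewrite /L mulmxDl -scalemxAl.
  have -> : k *: (u *m A) + v *m A - (k *: u + v) = k *: (u *m A - u) + (v *m A - v).
    by apply/rowP => i; rewrite !mxE; ring.
  by rewrite Nproj_linear !linearP.
pose f : {linear V -> V} := HB.pack L (GRing.isLinear.Build _ _ _ _ _ linL).
have [_ _ disc _] := latticeP M.
have [U nU Udisc] := disc _ Gg0.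
have [d d0 dU] := nbhs_radius nU.
have nearU : \forall w \near (0 : V), U (vsval g0 + L w).
  have /cvgrPdistC_lt/(_ d d0) : f w @[w --> (0 : V)] --> f 0.
    exact (@linear_rV_continuous R n _ f 0).
  by apply: filterS => w; rewrite linear0 subr0 => /dU.
have [r' r'0 rU] := nbhs_radius nearU.
have [B [isoB affB]] := gamma_affine n1 g0.
have small w : l (v0 D) w = 0 -> `|w| < r -> `|w| < r' -> w *m A = w *m B.
  move=> w0 wr wr'; have [g Gg gE] := rG w wr.
  have sE : l (v0 D) (y0 + w) = s by rewrite sformDr w0 addr0.
  have gK : K (Nproj D (G (y0 + w) - (y0 + w))) = g.
    by rewrite -gE Nproj_gamma// sE KE.
  have g0K : K (Nproj D (G y0 - y0)) = g0 by rewrite -g0E Nproj_gamma// KE.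
  have gg0 : vsval g = vsval g0 + L w.
    rewrite -gK affA -g0K /L -!linearD/=.
    have -> : G y0 + w *m A - (y0 + w) = 1 *: (G y0 - y0) + (w *m A - w).
      by apply/rowP => i; rewrite !mxE; ring.
    by rewrite Nproj_linear scale1r.
  have Eg : g = g0.
    by apply: Udisc => //; rewrite gg0; have := rU w wr'; rewrite add0r.
  have := gE; rewrite Eg affA affB g0E.
  by move/addrI.
have AB : forall v, v *m A = v *m B.
  apply: (isometry_mx_eq n1 isoA isoB) => w w0.
  (* Both sides are linear in [w], so agreement for short [w] extends to the whole hyperplane by
     rescaling. *)
  have rr : 0 < Num.min r r' by rewrite lt_min r0.
  have [k k0] := scaled_small w rr; rewrite lt_min => /andP[kr kr'].
  have := small (k *: w); rewrite sformZr w0 mulr0 => /(_ erefl kr kr').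
  by rewrite -!scalemxAl => /(scalerI k0).
exists g0 => // y; have -> : y = y0 + (y - y0) by rewrite addrC subrK.
by rewrite affA affB AB g0E.
Qed.

End Orbits.

(** * Global affine lifts of causal isometries *)

Section CausalIsometries.
Variables (R : realType) (n : nat).
Hypothesis n1 : (1 < n)%N.
Local Notation V := 'rV[R]_n.
Implicit Types (M : unipotent_manifold R n) (F : V -> V) (A : 'M[R]_n).

Lemma affine_continuous F A : affine_with F A -> continuous F.
Proof.
move=> aF x; apply: differentiable_continuous.
have -> : F = cst (F 0) + mulmxr A.
  by apply/funext => v; rewrite -[v in LHS]add0r aF.
apply: differentiableD => //; apply: linear_differentiable.
exact: linear_rV_continuous.
Qed.

Lemma affine_inverse F A : A \in unitmx -> affine_with F A ->
  exists F' : V -> V, [/\ affine_with F' (invmx A), cancel F F' & cancel F' F].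
Proof.
move=> Au aF; exists (fun v => (v - F 0) *m invmx A); split=> [u v|v|v].
- by rewrite -mulmxDl addrAC.
- by rewrite -[v in F v]add0r aF addrC addKr mulmxK.
- by rewrite -[X in F X]add0r aF mulmxKV// addrC subrK.
Qed.

(** Connectedness of the real line suffices, applied to the preimage of [S] on the line through 0
    and [v]. *)
Lemma connected_open_closed (S : set V) :
  open S -> closed S -> S 0 -> forall v, S v.
Proof.
move=> oS cS S0 v.
have cont : continuous (fun t : R => t *: v) by exact: scalel_continuous.
pose C := (fun t : R => t *: v) @^-1` S.
have : C = setT.
  have cT : connected [set: R] by apply/connected_intervalP => x y _ _ z.
  apply: cT.
  - by exists 0; rewrite /C/= scale0r.
  - exists C; last by rewrite setTI.
    by apply: open_comp oS => x _; exact: cont.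
  - exists C; last by rewrite setTI.
    by apply: closed_comp cS => x _; exact: cont.
by move=> CT; have : C 1 by [rewrite CT]; rewrite /C/= scale1r.
Qed.

Lemma nbhs_open_set (P : set V) : open [set p | \forall x \near p, P x].
Proof. by rewrite openE => p /= pP; exact: nbhs_interior. Qed.

Lemma causal_isometry_local_lift M M' f (p : V) : is_causal_isometry M M' f ->
  exists F A, [/\ isometry_mx (lform (udata M)) (lform (udata M')) A, affine_with F A
    & \forall x \near p, f (proj M x) = proj M' (F x)].
Proof.
move=> [_ /(_ p)[U [F [oU smF fF isoF _]]]].
have [|||||J [t [isoJ nearF]]] := @smooth_isometry_locally_affine R n
  (lform (udata M)) (lform (udata M')) U F p.
- exact: lorentzian_nondegenerate (lform_lorentzian _).
- exact: lorentzian_nondegenerate (lform_lorentzian _).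
- exact: oU.
- exact: smF.
- exact: isoF.
exists (fun x => x *m J + t), J; split=> //.
  by move=> u v; rewrite mulmxDl addrAC.
have nU := open_nbhs_nbhs oU.
by apply: filterS2 nU nearF => x Ux Fx; rewrite fF// Fx.
Qed.

(** The lift at 0 is continued over all of [V]: the points near which it still lifts [f] form an
    open and closed set. *)
Lemma causal_isometry_lift M M' f : is_causal_isometry M M' f ->
  exists F A, [/\ isometry_mx (lform (udata M)) (lform (udata M')) A, affine_with F A
    & forall x, f (proj M x) = proj M' (F x)].
Proof.
move=> isof.
have [F [A [isoA affA nearF]]] := causal_isometry_local_lift 0 isof.
exists F, A; split=> // x.
pose S := [set p : V | \forall x \near p, f (proj M x) = proj M' (F x)].
suff /(_ x) Sx : forall p : V, S p by exact: nbhs_singleton Sx.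
have ndl : nondegenerate_form (lform (udata M)).
  exact: lorentzian_nondegenerate (lform_lorentzian _).
have Au := isometry_mx_unit ndl isoA.
have [F' [affF' FK F'K]] := affine_inverse Au affA.
apply: connected_open_closed; [exact: nbhs_open_set| |exact: nearF].
move=> q clq.
(* For closedness, a local lift [H] at the limit point [q] is compared with [F] near a point [p]
   where both lift [f]. There [H \o F'] preserves lattice orbits, so it is globally a [gamma g], and
   [F] lifts [f] near [q] as well. *)
have [H [B [isoB affB nearH]]] := causal_isometry_local_lift q isof.
have [p [Sp pH]] := clq _ (nbhs_interior nearH).
have [|||g Gg gE] := @affine_isometry_preserving_orbits R n M' n1 (H \o F') (invmx A *m B) (F p).
- exact: isometry_mx_mul (isometry_mx_inv Au isoA) isoB.
- exact: affine_with_comp affF' affB.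
- have nearp : \forall x \near p, exists2 g, lattice M' g & gamma g (F x) = H x.
    apply: filterS2 Sp pH => y Sy Hy; apply/proj_eqP => //; by rewrite -Sy.
  have cF' := @affine_continuous _ _ affF' (F p); rewrite /continuous_at FK in cF'.
  have h : \forall y \near F p, exists2 g, lattice M' g &
    gamma g (F (F' y)) = H (F' y) := cF' _ nearp.
  by apply: filterS h => y /=; rewrite F'K.
apply: filterS nearH => y ->.
apply/esym/proj_eqP => //; exists g => //.
by rewrite -gE /= FK.
Qed.

(** The conjugate of [gamma g] by [F] maps every point into its own orbit, hence is itself given by
    a lattice element. In the opposite direction this rests on the injectivity of [f]. *)
Lemma causal_isometry_conjugates M M' f : is_causal_isometry M M' f ->
  exists F A, [/\ isometry_mx (lform (udata M)) (lform (udata M')) A, affine_with F A,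
     forall g, lattice M g -> exists2 g', lattice M' g' &
        forall v, F (gamma g v) = gamma g' (F v)
   & forall g', lattice M' g' -> exists2 g, lattice M g &
        forall v, F (gamma g v) = gamma g' (F v)].
Proof.
move=> isof; have [F [A [isoA affA fE]]] := causal_isometry_lift isof.
have ndl : nondegenerate_form (lform (udata M)).
  exact: lorentzian_nondegenerate (lform_lorentzian _).
have Au := isometry_mx_unit ndl isoA.
have [F' [affF' FK F'K]] := affine_inverse Au affA.
have isoA' := isometry_mx_inv Au isoA.
exists F, A; split=> // [g Gg|g' Gg'].
  have [B [isoB affB]] := gamma_affine n1 g.
  have [|||g' Gg' gE] := @affine_isometry_preserving_orbits R n M' n1
    (F \o (gamma g \o F')) (invmx A *m B *m A) 0.
  - exact: isometry_mx_mul (isometry_mx_mul isoA' isoB) isoA.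
  - exact: affine_with_comp (affine_with_comp affF' affB) affA.
  - apply: (@nearW V (nbhs (0 : V))) => y; apply/proj_eqP => //=; rewrite -fE -{1}(F'K y) -fE.
    by congr f; apply/proj_eqP => //; exists g.
  by exists g' => // v; rewrite -gE /= FK.
have [B [isoB affB]] := gamma_affine n1 g'.
have [|||g Gg gE] := @affine_isometry_preserving_orbits R n M n1
  (F' \o (gamma g' \o F)) (A *m B *m invmx A) 0.
- exact: isometry_mx_mul (isometry_mx_mul isoA isoB) isoA'.
- exact: affine_with_comp (affine_with_comp affA affB) affF'.
- apply: (@nearW V (nbhs (0 : V))) => y; apply/proj_eqP => //=.
  have [_ injf _] := isof.1.
  apply: injf; rewrite ?inE; [by exists y|by exists (F' (gamma g' (F y)))|].
  by rewrite !fE F'K; apply/proj_eqP => //; exists g'.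
by exists g => // v; rewrite -gE /= F'K.
Qed.

End CausalIsometries.

(** * Equivalence of the families of quadratic forms *)

Section QuadraticFormEquivalence.
Variables (R : realType) (n : nat).
Local Notation V := 'rV[R]_n.
Implicit Types (D : unipotent_data R n) (M : unipotent_manifold R n).

(** The relation does not see the lattice, so it passes through a change of lattice. The factor [c]
    may have either sign, in accordance with an arbitrary element of Aff(R) in the conclusion. *)
Definition qform_equiv D D' : Prop :=
  exists (Phi : 'Hom(subvs_of (Tsp D), subvs_of (Tsp D')))
         (Psi : 'Hom(subvs_of (Tsp D'), subvs_of (Tsp D))) (c d : R),
    [/\ cancel Phi Psi, cancel Psi Phi, c != 0
      & forall s x, qform s (Phi x) = qform (c * s + d) x].

Lemma qform_equiv_sym D D' : qform_equiv D D' -> qform_equiv D' D.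
Proof.
move=> [Phi [Psi [c [d [PK KP c0 E]]]]]; exists Psi, Phi, c^-1, (- (d / c)).
split=> //; first by rewrite invr_eq0.
by move=> s x; rewrite -[x in RHS]KP E; congr (qform _ _); field.
Qed.

Lemma qform_equiv_trans D2 D1 D3 :
  qform_equiv D1 D2 -> qform_equiv D2 D3 -> qform_equiv D1 D3.
Proof.
move=> [Phi [Psi [c [d [PK KP c0 E]]]]] [Phi' [Psi' [c' [d' [PK' KP' c0' E']]]]].
exists (Phi' \o Phi)%VF, (Psi \o Psi')%VF, (c * c'), (c * d' + d).
split; [| |exact: mulf_neq0|] => x.
- by rewrite !comp_lfunE PK' PK.
- by rewrite !comp_lfunE KP KP'.
- by move=> y; rewrite comp_lfunE E' E; congr (qform _ _); ring.
Qed.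

(** By cocompactness [f] takes all its values on a compact set, so it is bounded; a bounded linear
    map is zero. Thus linear identities need checking on the lattice only. *)
Lemma lattice_linear_eq0 M (f : {linear subvs_of (Tsp (udata M)) -> V}) :
  (forall g, lattice M g -> f g = 0) -> forall x, f x = 0.
Proof.
move=> f0 x.
have [_ _ _ [K cK [_ KG]]] := latticeP M.
pose L := [the {linear V -> V} of f \o vsproj (Tsp (udata M))].
have LE y : L (vsval y) = f y by rewrite /= vsvalK.
have cL : compact (L @` K).
  apply: continuous_compact cK; apply: continuous_subspaceT.
  exact: linear_rV_continuous.
have [B [_ /(_ (B + 1)) BP]] := compact_bounded cL.
have {}BP v : K v -> `|L v| <= B + 1.
  by move=> Kv; apply: BP; [rewrite ltrDl|exists v].
have bnd y : `|f y| <= B + 1.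
  have [g [Gg Kg]] := KG y.
  by have := BP _ Kg; rewrite LE linearB (f0 g)// subr0.
apply/eqP; rewrite -normr_le0 leNgt; apply/negP => fx.
(* The multiple of [x] is chosen so that its image would have norm at least [B + 2]. *)
have := bnd (((B + 2) / `|f x|) *: x).
rewrite linearZ normrZ normrM normfV normr_id -mulrA mulVf ?gt_eqF// mulr1.
by move=> h; have := le_trans (ler_norm _) h; rewrite lerD2l leNgt ltr1n.
Qed.

(** [Phi] is injective because the form at parameter 0 is definite. It is onto because the
    projection to a complement of its image kills the lattice, hence everything. *)
Lemma qform_equiv_of_lattice M M'
    (Phi : 'Hom(subvs_of (Tsp (udata M)), subvs_of (Tsp (udata M')))) (c d : R) :
  (1 < n)%N -> c != 0 ->
  (forall s x, qform s (Phi x) = qform (c * s + d) x) ->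
  (forall g', lattice M' g' -> exists g, Phi g = g') ->
  qform_equiv (udata M) (udata M').
Proof.
move=> n1 c0 E sur.
have k0 : lker Phi == 0%VS.
  apply/lker0P => x y /eqP; rewrite -subr_eq0 -linearB => /eqP Pxy.
  apply/eqP; rewrite -subr_eq0; apply/eqP/val_inj.
  (* This value of [s] makes the parameter [c * s + d] vanish. *)
  have := E (- (d / c)) (x - y); rewrite Pxy.
  have -> : c * (- (d / c)) + d = 0 by field.
  rewrite /qform !linear0 ?scaler0 scale0r !addr0 sform0l oppr0 => /esym/eqP.
  rewrite oppr_eq0 => /eqP h.
  by apply: (N_anisotropic n1) h; exact: Tsp_sub_N.
have full y : y \in limg Phi.
  pose f := [the {linear _ -> V} of vsval \o (\1 - projv (limg Phi))%VF].
  have fE z : f z = vsval (z - projv (limg Phi) z).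
    by rewrite /= !lfunE/= !lfunE.
  have f0 : forall z, f z = 0.
    apply: lattice_linear_eq0 => g' /sur[g <-].
    by rewrite fE projv_id ?subrr ?linear0// memv_img// memvf.
  have := f0 y; rewrite fE => h.
  have /eqP : y - projv (limg Phi) y = 0 by apply: val_inj; exact: h.
  by rewrite subr_eq0 => /eqP ->; exact: memv_proj.
exists Phi, (Phi^-1)%VF, c, d; split=> //.
- exact: lker0_lfunK.
- by move=> y; exact: limg_lfunVK.
Qed.

End QuadraticFormEquivalence.

(** * Comparison of two conjugate lattice actions *)

Section ConjugateActions.
Variables (R : realType) (n : nat) (M M' : unipotent_manifold R n).
Hypothesis n1 : (1 < n)%N.
Local Notation V := 'rV[R]_n.
Local Notation D := (udata M).
Local Notation D' := (udata M').
Local Notation T := (subvs_of (Tsp D)).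
Local Notation T' := (subvs_of (Tsp D')).
Local Notation l := (lform D).
Local Notation l' := (lform D').
Local Notation a := (amap D).
Local Notation a' := (amap D').
Variables (F : V -> V) (A : 'M[R]_n).
Hypothesis isoA : isometry_mx l l' A.
Hypothesis affA : affine_with F A.

Definition conj_actions (g : T) (g' : T') :=
  forall v, F (gamma g v) = gamma g' (F v).

Hypothesis conj_lattice :
  forall g, lattice M g -> exists2 g', lattice M' g' & conj_actions g g'.
Hypothesis conj_lattice' :
  forall g', lattice M' g' -> exists2 g, lattice M g & conj_actions g g'.

Lemma isometry_unit : A \in unitmx.
Proof. exact: isometry_mx_unit (lorentzian_nondegenerate (lform_lorentzian D)) isoA. Qed.

Lemma conj_displacement g g' v : conj_actions g g' ->
  (gamma g v - v) *m A = gamma g' (F v) - F v.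
Proof. by move=> c; rewrite -c (affine_withB _ _ affA). Qed.

Lemma Nproj_conj g g' v : conj_actions g g' ->
  Nproj D' ((gamma g v - v) *m A) = vsval g' + l' (v0 D') (F v) *: a' g'.
Proof. by move=> /conj_displacement ->; rewrite Nproj_gamma. Qed.

Section TrivialLinearPart.
Hypothesis a0 : forall g, lattice M g -> a g = 0.

Lemma gamma_translation g v : a g = 0 -> gamma g v = v + vsval g.
Proof.
move=> ag; rewrite gammaE ag !sform0l.
by apply/rowP => i; rewrite !mxE; ring.
Qed.

(** A translation has constant displacement. Evaluating it where [F] takes the values 0 and [v1 D']
    isolates [a' g'], which must vanish. *)
Lemma conj_translation g g' : lattice M g -> conj_actions g g' ->
  a' g' = 0 /\ vsval g *m A = vsval g'.
Proof.
move=> Gg c.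
have E v := conj_displacement v c.
have E' v := Nproj_conj v c.
have tr v : gamma g v - v = vsval g by rewrite gamma_translation ?a0// addrC addKr.
have [F' [_ FK F'K]] := affine_inverse isometry_unit affA.
have ag' : a' g' = 0.
  have := E' (F' 0); have := E' (F' (v1 D')); rewrite !tr !F'K sform0r.
  move=> ->; rewrite lform_v0_v1 scale0r scale1r => /addrI //.
split=> //; have := E 0; rewrite tr => ->.
by rewrite gammaE ag' !sform0l; apply/rowP => i; rewrite !mxE; ring.
Qed.

Lemma qform_equiv_trivial : qform_equiv D D'.
Proof.
pose Phi : 'Hom(T, T') := linfun [the {linear T -> T'} of
  vsproj (Tsp D') \o (mulmxr A \o vsval)].
have PhiE x : Phi x = vsproj (Tsp D') (vsval x *m A) by rewrite lfunE.
have PhiG g g' : lattice M g -> conj_actions g g' -> Phi g = g'.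
  by move=> Gg /(conj_translation Gg)[_ gE]; rewrite PhiE gE vsvalK.
(* [Phi] is defined through a projection onto [Tsp D']; agreement on the lattice shows that the
   projection changes nothing. *)
have vsPhi x : vsval (Phi x) = vsval x *m A.
  apply/eqP; rewrite -subr_eq0; apply/eqP.
  pose f := [the {linear T -> V} of (vsval \o Phi) \- (mulmxr A \o vsval)].
  apply: (@lattice_linear_eq0 R n M f) => g Gg; rewrite /f/=.
  have [g' Gg' c] := conj_lattice Gg.
  by rewrite (PhiG _ _ Gg c) (conj_translation Gg c).2 subrr.
have aPhi x : a' (Phi x) = 0.
  apply: (@lattice_linear_eq0 R n M [the {linear T -> V} of a' \o Phi]) => g Gg /=.
  have [g' Gg' c] := conj_lattice Gg.
  by rewrite (PhiG _ _ Gg c) (conj_translation Gg c).1.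
apply: (@qform_equiv_of_lattice R n M M' Phi 1 0 n1) => [|s x|g' Gg'].
- exact: oner_neq0.
- have ax : a x = 0 by exact: (@lattice_linear_eq0 R n M a).
  by rewrite /qform aPhi vsPhi ax !scaler0 !addr0 isoA.
- have [g Gg c] := conj_lattice' Gg'; exists g; exact: PhiG c.
Qed.

End TrivialLinearPart.

Section NontrivialLinearPart.
Variable g1 : T.
Hypothesis g1_lattice : lattice M g1.
Hypothesis ag1 : a g1 != 0.

Lemma gamma_lambda (E : unipotent_data R n) (g : subvs_of (Tsp E)) (u w : V) :
  gamma g (u + w) - gamma g u = lambda g w.
Proof. by rewrite /gamma /lambda /l0 !sformE; apply/rowP => i; rewrite !mxE; ring. Qed.

Lemma conj_lambda g g' w : conj_actions g g' -> lambda g w *m A = lambda g' (w *m A).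
Proof.
move=> c; rewrite -(gamma_lambda g 0) -(gamma_lambda g' (F 0)) -affA -!c.
by rewrite (affine_withB _ _ affA).
Qed.

Lemma lambda_nilpotent (E : unipotent_data R n) (g : subvs_of (Tsp E)) (w : V) :
  lambda g (lambda g w - w) - (lambda g w - w) =
  - (l0 E w * lform E (amap E g) (amap E g)) *: v0 E.
Proof.
rewrite /lambda /l0 !sformE !ortho_simpl//.
by apply/rowP => i; rewrite !mxE; field.
Qed.

(** The square of [lambda g1 - 1] maps [v1] to a nonzero multiple of [v0], as [a g1] is not
    isotropic; its conjugate has image in the line of [v0 D']. *)
Lemma v0_conj : exists2 k, k != 0 & v0 D *m A = k *: v0 D'.
Proof.
have [g' Gg' c] := conj_lattice g1_lattice.
have cl w : (lambda g1 w - w) *m A = lambda g' (w *m A) - w *m A.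
  by rewrite mulmxBl (conj_lambda _ c).
have := cl (lambda g1 (v1 D) - v1 D); rewrite lambda_nilpotent// cl lambda_nilpotent//.
rewrite /l0 lform_v0_v1 mul1r -scalemxAl => E.
pose q := l (a g1) (a g1).
have q0 : q != 0.
  by apply: contra_neq ag1 => q0; apply: (N_anisotropic n1) q0; exact: amap_sub_N.
exists (- q^-1 * - (l' (v0 D') (v1 D *m A) * l' (a' g') (a' g'))); last first.
  by rewrite -scalerA -E scalerA mulrNN mulVf// scale1r.
set k := _ * _; apply: contraT; rewrite negbK => /eqP k0.
have : v0 D *m A = 0.
  by rewrite -[LHS]scale1r -(mulVf q0) -mulrNN -scalerA E scalerA -/k k0 scale0r.
move=> v0A; have := isoA (v0 D) (v1 D); rewrite v0A sform0l lform_v0_v1 => /eqP.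
by rewrite eq_sym oner_eq0.
Qed.

Lemma qform_equiv_nontrivial : qform_equiv D D'.
Proof.
have [k k0 v0A] := v0_conj.
have v0'A v : l' (v0 D') (v *m A) = k^-1 * l (v0 D) v.
  by rewrite -isoA v0A sformZl mulKf.
(* The number [h] is the shift of the parameter caused by the translation part of [F]. *)
pose h := l' (v0 D') (F 0).
have v0'F v : l' (v0 D') (F v) = h + k^-1 * l (v0 D) v.
  by rewrite -[v in F v]add0r affA sformDr v0'A.
pose P := Nproj D'.
have PD u v : P (u + v) = P u + P v.
  by have := Nproj_linear D' 1 u v; rewrite !scale1r.
have PZ (t : R) u : P (t *: u) = t *: P u.
  have P0 : P 0 = 0 by rewrite /P /Nproj sform0r scale0r subr0.
  by have := Nproj_linear D' t u 0; rewrite !addr0 -/P P0 addr0.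
have Pv0 : P (v0 D') = 0 by have := Nproj_v0 D' 1; rewrite scale1r.
have PE g g' v : conj_actions g g' ->
    P (vsval g *m A) + l (v0 D) v *: P (a g *m A) = 
    vsval g' + (h + k^-1 * l (v0 D) v) *: a' g'.
  move=> c; have := Nproj_conj v c; rewrite -/P v0'F => <-.
  rewrite gammaE; set t := (_ + _ : R).
  have -> : v + (l (v0 D) v *: a g + vsval g) - t *: v0 D - v =
    vsval g + l (v0 D) v *: a g - t *: v0 D.
    by apply/rowP => i; rewrite !mxE; ring.
  rewrite mulmxBl mulmxDl -!scalemxAl v0A PD PD PZ -scaleNr scalerA PZ.
  by rewrite Pv0 scaler0 addr0.
(* Evaluation at [v = 0] and at [v = v1 D], where [l (v0 D)] is 0 and 1, separates the two
   coefficients of the affine identity [PE]. *)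
have P0 g g' : conj_actions g g' -> P (vsval g *m A) = vsval g' + h *: a' g'.
  by move=> c; have := PE g g' 0 c; rewrite sform0r mulr0 addr0 scale0r addr0.
have P1 g g' : conj_actions g g' -> a' g' = k *: P (a g *m A).
  move=> c; have := PE g g' (v1 D) c; rewrite lform_v0_v1 mulr1 scale1r (P0 _ _ c).
  rewrite scalerDl (addrA (vsval g')) => /addrI E.
  by rewrite E scalerA mulfV// scale1r.
have [K KE] := one_plus_amap_inverse M' h.
have linP : linear P by move=> t u v; rewrite PD PZ.
pose fP : {linear V -> V} := HB.pack P (GRing.isLinear.Build _ _ _ _ _ linP).
pose Phi : 'Hom(T, T') := linfun [the {linear T -> T'} of
  K \o (fP \o (mulmxr A \o vsval))].
have PhiE x : Phi x = K (P (vsval x *m A)) by rewrite lfunE.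
have PhiG g g' : conj_actions g g' -> Phi g = g'.
  by move=> c; rewrite PhiE (P0 _ _ c) KE.
have Phi0 x : vsval (Phi x) + h *: a' (Phi x) = P (vsval x *m A).
  apply/eqP; rewrite -subr_eq0; apply/eqP.
  pose f := [the {linear T -> V} of
    ((vsval \o Phi) \+ (h \*: (a' \o Phi))) \- (fP \o (mulmxr A \o vsval))].
  apply: (@lattice_linear_eq0 R n M f) => g Gg; rewrite /f/=.
  have [g' Gg' c] := conj_lattice Gg.
  by rewrite (PhiG _ _ c) -(P0 _ _ c) subrr.
have Phi1 x : a' (Phi x) = k *: P (a x *m A).
  apply/eqP; rewrite -subr_eq0; apply/eqP.
  pose f := [the {linear T -> V} of
    (a' \o Phi) \- (k \*: (fP \o (mulmxr A \o a)))].
  apply: (@lattice_linear_eq0 R n M f) => g Gg; rewrite /f/=.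
  have [g' Gg' c] := conj_lattice Gg.
  by rewrite (PhiG _ _ c) -(P1 _ _ c) subrr.
apply: (@qform_equiv_of_lattice R n M M' Phi k (- (k * h)) n1 k0) => [s x|g' Gg'].
  pose t := k * s - k * h; pose z := vsval x + t *: a x.
  rewrite /qform.
  (* [Phi0] gives the value at [s = h], and [Phi1] the slope; together they give the parameter
     [t = k * (s - h)]. *)
  have -> : vsval (Phi x) + s *: a' (Phi x) = P (z *m A).
    rewrite mulmxDl -scalemxAl PD PZ -Phi0 -addrA; congr (_ + _).
    rewrite Phi1 !scalerA -scalerDl; congr (_ *: _); rewrite /t; ring.
  have z0 : l' (v0 D') (z *m A) = 0.
    by rewrite v0'A sformDr sformZr v0_T v0_amap mulr0 addr0 mulr0.
  by rewrite /P Nproj_sform// isoA.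
by have [g Gg c] := conj_lattice' Gg'; exists g; exact: PhiG c.
Qed.

End NontrivialLinearPart.

End ConjugateActions.

Theorem causally_isometric_qform_equiv (R : realType) (n : nat)
  (M M' : unipotent_manifold R n) : (1 < n)%N ->
  causally_isometric M M' -> qform_equiv (udata M) (udata M').
Proof.
move=> n1 [f /(causal_isometry_conjugates n1)[F [A [isoA affA c c']]]].
have [a0|] := pselect (forall g, lattice M g -> amap (udata M) g = 0).
  exact: qform_equiv_trivial isoA affA c c' a0.
move/existsNP => [g /not_implyP[Gg /eqP ag]].
exact (qform_equiv_nontrivial n1 isoA affA c c' Gg ag).
Qed.

(** * Symmetric pencils and their spectra *)

Section SymmetricPencil.
Variable R : realType.

Lemma inner_mulmxl m p (P : 'M[R]_(m, p)) (S : 'M[R]_m) (z : 'cV[R]_p) :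
  inner (S *m (P *m z)) (P *m z) = inner ((P^T *m S *m P) *m z) z.
Proof. by rewrite /inner !trmx_mul trmxK !mulmxA. Qed.

Lemma innerB m (S S' : 'M[R]_m) (z : 'cV[R]_m) :
  inner ((S - S') *m z) z = inner (S *m z) z - inner (S' *m z) z.
Proof. by rewrite /inner mulmxBl linearB/= mulmxBl mxE [in X in _ + X]mxE. Qed.

Lemma symmetric_inner_eq0 m (S : 'M[R]_m) : S^T = S ->
  (forall z, inner (S *m z) z = 0) -> S = 0.
Proof.
move=> symS S0; apply/matrixP => i j; rewrite [RHS]mxE.
have e k h : ((delta_mx k 0)^T *m S *m delta_mx h 0 : 'M[R]_1) 0 0 = S k h.
  by rewrite trmx_delta -rowE -colE !mxE.
have := S0 (delta_mx i 0 + delta_mx j 0).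
have := S0 (delta_mx i 0); have := S0 (delta_mx j 0).
have addE (X Y : 'M[R]_1) : (X + Y) 0 0 = X 0 0 + Y 0 0 by rewrite mxE.
rewrite /inner !trmx_mul symS !linearD/= !mulmxDl !addE !e.
have -> : S j i = S i j by rewrite -[in LHS]symS mxE.
move=> -> ->; rewrite add0r addr0 => /eqP.
by rewrite -mulr2n mulrn_eq0/= => /eqP.
Qed.

Lemma symmetric_inner_eq m (S S' : 'M[R]_m) : S^T = S -> S'^T = S' ->
  (forall z, inner (S *m z) z = inner (S' *m z) z) -> S = S'.
Proof.
move=> symS symS' E; apply/eqP; rewrite -subr_eq0; apply/eqP.
apply: symmetric_inner_eq0 => [|z]; first by rewrite linearB/= symS symS'.
by rewrite innerB E subrr.
Qed.

Lemma posdef_unitmx m (S : 'M[R]_m) : posdef S -> S \in unitmx.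
Proof.
move=> [symS S0].
rewrite -row_free_unit -kermx_eq0; apply/eqP/row_matrixP => i; rewrite row0.
set u := row i _; apply/eqP; apply: contraT => un0.
have uS : u *m S = 0 by rewrite -row_mul mulmx_ker row0.
have := S0 u^T; rewrite trmx_eq0 => /(_ un0).
by rewrite /inner trmx_mul trmxK symS uS mul0mx mxE ltxx.
Qed.

Lemma posdef_ge0 m (S : 'M[R]_m) (x : 'rV[R]_m) : posdef S ->
  0 <= (x *m S *m x^T) 0 0 ?= iff (x == 0).
Proof.
move=> [symS S0]; have := S0 x^T; rewrite /inner trmx_mul trmxK symS trmx_eq0.
have [->|xn0 /(_ isT) h] := eqVneq x 0; last by split; [exact: ltW|rewrite lt_eqF].
by move=> _; split; rewrite !mul0mx mxE ?lexx ?eqxx.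
Qed.

Lemma quadratic_mx_coef m (A B C A' B' C' : 'M[R]_m) :
  (forall s : R, A + s *: B + s ^+ 2 *: C = A' + s *: B' + s ^+ 2 *: C') ->
  [/\ A = A', B = B' & C = C'].
Proof.
move=> E.
have E' i j (s : R) : A i j + s * B i j + s ^+ 2 * C i j =
    A' i j + s * B' i j + s ^+ 2 * C' i j.
  by have := congr1 (fun X : 'M[R]_m => X i j) (E s); rewrite !mxE.
(* The values at 0, 1 and -1 determine the three coefficients. *)
by split; apply/matrixP => i j; have := E' i j 0; have := E' i j 1;
  have := E' i j (-1); lra.
Qed.

(** [is_char_poly] imposes symmetry on the realization's coefficients; for [A], [B], [C] it is
    recovered from the symmetry of all values of the polynomial. *)
Lemma symmetric_qpoly m (A B C : 'M[R]_m) : 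
  (forall s, (qpoly A B C s)^T = qpoly A B C s) -> [/\ A^T = A, B^T = B & C^T = C].
Proof.
move=> E; suff [-> EB ->] : [/\ A^T = A, 2 *: B^T = 2 *: B & C^T = C].
  by split=> //; apply: (scalerI _ EB); rewrite pnatr_eq0.
apply: quadratic_mx_coef => s; have := E s.
rewrite /qpoly => Es; apply/matrixP => i j.
by have := congr1 (fun X : 'M[R]_m => X i j) Es; rewrite !mxE !mulrA (mulrC s 2).
Qed.

Lemma pencil_congruence m (A B C A' B' C' P : 'M[R]_m) (u w : R) : u != 0 ->
  (forall s, P^T *m qpoly A' B' C' s *m P = qpoly A B C (u * s + w)) ->
  P^T *m C' *m P = u ^+ 2 *: C /\ P^T *m B' *m P = u *: B + (u * w) *: C.
Proof.
move=> u0 E.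
have [|_ E1 ->] := @quadratic_mx_coef m (P^T *m A' *m P) (2 *: (P^T *m B' *m P))
  (P^T *m C' *m P) (A + (2 * w) *: B + w ^+ 2 *: C)
  (2 *: (u *: B + (u * w) *: C)) (u ^+ 2 *: C); last first.
  by split=> //; apply: (scalerI _ E1); rewrite pnatr_eq0.
move=> s; have := E s; rewrite /qpoly !mulmxDr !mulmxDl -!scalemxAr -!scalemxAl.
rewrite (scalerA s) (mulrC s) => ->.
by apply/matrixP => i j; rewrite !mxE; ring.
Qed.

(** After multiplication on the right by [C' *m P], both sides become [u ^+ 2 *: B]. *)
Lemma pencil_similarity m (B C B' C' P : 'M[R]_m) (u w : R) : u != 0 ->
  C \in unitmx -> C' \in unitmx -> P \in unitmx ->
  P^T *m C' *m P = u ^+ 2 *: C -> P^T *m B' *m P = u *: B + (u * w) *: C ->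
  B *m invmx C *m P^T = P^T *m (u *: (B' *m invmx C') - w%:M).
Proof.
move=> u0 Cu Cu' Pu EC EB.
have CPu : C' *m P \in unitmx by rewrite unitmx_mul Cu' Pu.
apply: (can_inj (mulmxK CPu)).
rewrite -[LHS]mulmxA (mulmxA P^T C') EC -scalemxAr mulmxKV//.
rewrite -mulmxA mulmxBl -scalemxAl !mulmxA mulmxKV// mul_scalar_mx.
rewrite mulmxBr -!scalemxAl -!scalemxAr !mulmxA EB EC.
by apply/matrixP => i j; rewrite !mxE; ring.
Qed.

(** Eigenvectors are rows here: [v |-> v *m Q] carries those of [X] to those of [Y]. *)
Lemma sp_affine_similar m (X Y Q : 'M[R]_m) (u w : R) : u != 0 ->
  Q \in unitmx -> X *m Q = Q *m (u *: Y - w%:M) ->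
  sp X = [set real_complex R u * z + real_complex R (- w) | z in sp Y].
Proof.
move=> u0 Qu XQ; pose c := map_mx (real_complex R) : 'M[R]_m -> 'M[R[i]]_m.
have cQu : c Q \in unitmx by rewrite map_unitmx.
have uc0 : real_complex R u != 0 by rewrite fmorph_eq0.
have cXQ : c X *m c Q = c Q *m (real_complex R u *: c Y - (real_complex R w)%:M).
  by rewrite /c -map_mxM XQ map_mxM map_mxB map_mxZ map_scalar_mx.
apply/seteqP; split => z /=; rewrite /sp/=.
  move=> /eigenvalueP[v vX vn0].
  exists ((z + real_complex R w) / real_complex R u); last first.
    by rewrite mulrC divfK// rmorphN addrK.
  apply/eigenvalueP; exists (v *m c Q); last first.
    by apply: contra_neq vn0 => v0; rewrite -(mulmxK cQu v) v0 mul0mx.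
  have := congr1 (mulmx v) cXQ; rewrite !mulmxA vX -scalemxAl mulmxBr mul_mx_scalar.
  move/eqP; rewrite eq_sym subr_eq -scalerDl -scalemxAr => /eqP h.
  by rewrite mulrC -scalerA -h scalerA mulVf// scale1r.
move=> [y /eigenvalueP[v vY vn0] <-].
apply/eigenvalueP; exists (v *m invmx (c Q)); last first.
  by apply: contra_neq vn0 => v0; rewrite -(mulmxKV cQu v) v0 mul0mx.
apply: (can_inj (mulmxK cQu)).
rewrite -[LHS]mulmxA [map_mx _ X *m _]cXQ mulmxA mulmxKV// mulmxBr -scalemxAr vY.
rewrite mul_mx_scalar.
by rewrite scalerA -scaleNr -scalerDl rmorphN -scalemxAl mulmxKV.
Qed.

Lemma Re_add (x y : R[i]) : complex.Re (x + y) = complex.Re x + complex.Re y.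
Proof. by case: x; case: y. Qed.

Lemma Im_add (x y : R[i]) : complex.Im (x + y) = complex.Im x + complex.Im y.
Proof. by case: x; case: y. Qed.

(* Comparing the real and imaginary parts of [v B = z v C] for [v = x + i y],
   [x B y^T = y B x^T] leaves [Im z * (x C x^T + y C y^T) = 0]. *)
Lemma sp_symmetric_pencil_real m (B C : 'M[R]_m) : B^T = B -> posdef C ->
  forall z, sp (B *m invmx C) z -> z \is Num.real.
Proof.
move=> symB pC [a b] /eigenvalueP[v vBC vn0].
have Cu := posdef_unitmx pC.
pose c := map_mx (real_complex R) : 'M[R]_m -> 'M[R[i]]_m.
have vB : v *m c B = (a +i* b)%C *: (v *m c C).
  rewrite scalemxAl -vBC -mulmxA; congr (v *m _).
  by rewrite /c -map_mxM mulmxKV.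
pose x := map_mx (@complex.Re R) v; pose y := map_mx (@complex.Im R) v.
have ReM (X : 'M[R]_m) : map_mx (@complex.Re R) (v *m c X) = x *m X.
  apply/rowP => j; rewrite !mxE (big_morph _ Re_add (erefl _)).
  by apply: eq_bigr => k _; rewrite !mxE; case: (v 0 k) => p q /=; ring.
have ImM (X : 'M[R]_m) : map_mx (@complex.Im R) (v *m c X) = y *m X.
  apply/rowP => j; rewrite !mxE (big_morph _ Im_add (erefl _)).
  by apply: eq_bigr => k _; rewrite !mxE; case: (v 0 k) => p q /=; ring.
have xB : x *m B = a *: (x *m C) - b *: (y *m C).
  rewrite -ReM vB -ReM -ImM; apply/rowP => j; rewrite !mxE.
  by case: (\sum_k _) => p q /=.
have yB : y *m B = a *: (y *m C) + b *: (x *m C).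
  rewrite -ImM vB -ReM -ImM; apply/rowP => j; rewrite !mxE.
  by case: (\sum_k _) => p q /=.
have sym (X : 'M[R]_m) : X^T = X -> (x *m X *m y^T) 0 0 = (y *m X *m x^T) 0 0.
  by move=> sX; rewrite -[in LHS](trmxK x) -{1}sX -!trmx_mul mxE mulmxA.
have := sym B symB; rewrite xB yB mulmxBl mulmxDl -!scalemxAl.
move=> E; have {E} : b * ((x *m C *m x^T) 0 0 + (y *m C *m y^T) 0 0) = 0.
  have entries (X : 'M[R]_1) (Y Z W : 'M[R]_1) :
      (a *: X - b *: Y) 0 0 = (a *: Z + b *: W) 0 0 -> X 0 0 = Z 0 0 ->
      b * (W 0 0 + Y 0 0) = 0.
    by rewrite !mxE => h xz; rewrite xz in h; lra.
  exact: entries E (sym C pC.1).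
move/eqP; rewrite mulf_eq0 => /orP[/eqP ->|]; first by rewrite complex_real.
have [x0 xE] := posdef_ge0 x pC; have [y0 yE] := posdef_ge0 y pC.
rewrite paddr_eq0// ![_ == 0]eq_sym xE yE => /andP[/eqP xx /eqP yy]; case/eqP: vn0.
apply/rowP => j; rewrite [RHS]mxE; apply/eqP; rewrite eq_complex/=.
have := congr1 (fun X : 'rV[R]_m => X 0 j) xx.
have := congr1 (fun X : 'rV[R]_m => X 0 j) yy.
by rewrite !mxE => -> ->; rewrite eqxx.
Qed.

End SymmetricPencil.

(** * Congruence of characteristic polynomials *)

Section CharacteristicPolynomials.
Variables (R : realType).

Lemma linear_cV_mx m p (h : {linear 'cV[R]_m -> 'cV[R]_p}) :
  exists P : 'M[R]_(p, m), forall z, h z = P *m z.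
Proof.
exists (\matrix_(i, j) h (delta_mx j 0) i 0) => z; apply/colP => i.
rewrite {1}(matrix_sum_delta z) linear_sum summxE mxE; apply: eq_bigr => j _.
by rewrite big_ord1 linearZ !mxE mulrC.
Qed.

Lemma mulmx_cV_id m (X : 'M[R]_m) : (forall z : 'cV[R]_m, X *m z = z) -> X = 1%:M.
Proof.
move=> H; apply/matrixP => i j.
have := congr1 (fun v : 'cV[R]_m => v i 0) (H (delta_mx j 0)).
by rewrite -colE !mxE andbT.
Qed.

Lemma linear_bijection_dim m p (P : 'M[R]_(p, m)) (P' : 'M[R]_(m, p)) :
  P' *m P = 1%:M -> P *m P' = 1%:M -> m = p.
Proof.
have le k h (X : 'M[R]_(k, h)) (Y : 'M[R]_(h, k)) : X *m Y = 1%:M -> (k <= h)%N.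
  move=> XY; rewrite -(mxrank1 R k) -XY.
  exact: leq_trans (mxrankM_maxl X Y) (rank_leq_col X).
by move=> h1 h2; apply/eqP; rewrite eqn_leq (le _ _ _ _ h1) (le _ _ _ _ h2).
Qed.

Lemma is_char_poly_qform n (M : unipotent_manifold R n) m (A B C : 'M[R]_m) :
  is_char_poly M A B C ->
  exists2 M1, causally_isometric M M1 &
  exists (iota : {linear 'cV[R]_m -> subvs_of (Tsp (udata M1))}) (c d : R),
  [/\ bijective iota, c != 0, forall s, (qpoly A B C s)^T = qpoly A B C s
   & forall z s, inner (qpoly A B C s *m z) z = qform (c * s + d) (iota z)].
Proof.
move=> [M1 [A1 [B1 [C1 [c [d [MM1 [iota [bij _ [sA sB sC] E]] c0 Q]]]]]]].
exists M1 => //; exists iota, c, d; split=> //; first by rewrite gt_eqF.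
- by move=> s; rewrite Q /qpoly !linearD/= !linearZ/= sA sB sC.
- by move=> z s; rewrite Q E.
Qed.

(** The realizations of both polynomials are joined to the common data [D] by equivalences; [P] is
    the matrix of the composite in the coordinates [iota] and [iota']. *)
Lemma char_poly_congruence n (M Mt : unipotent_manifold R n) m mt
    (A B C : 'M[R]_m) (At Bt Ct : 'M[R]_mt) : (1 < n)%N ->
  almost_causally_isometric M Mt ->
  is_char_poly M A B C -> is_char_poly Mt At Bt Ct ->
  exists (P : 'M[R]_(mt, m)) (P' : 'M[R]_(m, mt)) (u w : R),
  [/\ P' *m P = 1%:M, P *m P' = 1%:M, u != 0
   & forall s, P^T *m qpoly At Bt Ct s *m P = qpoly A B C (u * s + w)].
Proof.
move=> n1 [D [G [Gt [GP [GtP [MD MtD]]]]]].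
move=> /is_char_poly_qform[M1 MM1 [iota [c [d [[g gK Kg] c0 sQ E]]]]].
move=> /is_char_poly_qform[M2 MM2 [iota' [c' [d' [[g' gK' Kg'] c0' sQ' E']]]]].
have M1D : qform_equiv (udata M1) D.
  apply: (qform_equiv_trans (D2 := udata M)).
    exact/qform_equiv_sym/causally_isometric_qform_equiv.
  exact: (causally_isometric_qform_equiv n1 MD).
have M2D : qform_equiv (udata M2) D.
  apply: (qform_equiv_trans (D2 := udata Mt)).
    exact/qform_equiv_sym/causally_isometric_qform_equiv.
  exact: (causally_isometric_qform_equiv n1 MtD).
have [Phi [Psi [k [h [PK KP k0 Ek]]]]] := qform_equiv_trans M1D (qform_equiv_sym M2D).
pose f : {linear _ -> 'cV[R]_m} := HB.pack g
  (GRing.isLinear.Build _ _ _ _ _ (can2_linear gK Kg)).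
pose f' : {linear _ -> 'cV[R]_mt} := HB.pack g'
  (GRing.isLinear.Build _ _ _ _ _ (can2_linear gK' Kg')).
have [P PE] := linear_cV_mx [the {linear 'cV[R]_m -> 'cV[R]_mt} of f' \o (Phi \o iota)].
have [P' PE'] := linear_cV_mx [the {linear 'cV[R]_mt -> 'cV[R]_m} of f \o (Psi \o iota')].
rewrite /= in PE PE'.
(* The new parameter solves [c * x + d = k * (c' * s + d') + h] for [x]. *)
exists P, P', (k * c' / c), ((k * d' + h - d) / c); split.
- by apply: mulmx_cV_id => z; rewrite -mulmxA -PE -PE' Kg' PK gK.
- by apply: mulmx_cV_id => z; rewrite -mulmxA -PE' -PE Kg KP gK'.
- by rewrite !mulf_neq0// invr_eq0.
move=> s; apply: symmetric_inner_eq => [|//|z].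
  by rewrite !trmx_mul trmxK sQ' mulmxA.
rewrite -inner_mulmxl E' -PE Kg' Ek E; congr (qform _ _); field; exact: c0.
Qed.

End CharacteristicPolynomials.

Theorem proposition4 (R : realType) (n : nat) (n_ge2 : (2 <= n)%N)
    (M Mt : unipotent_manifold R n)
    (MMt : almost_causally_isometric M Mt)
    (m mt : nat) (A B C : 'M[R]_m) (At Bt Ct : 'M[R]_mt)
    (QM : is_char_poly M A B C) (QMt : is_char_poly Mt At Bt Ct)
    (C_gt0 : posdef C) (Ct_gt0 : posdef Ct) :
  (forall z, sp (B *m invmx C) z -> z \is Num.real) /\
  (forall z, sp (Bt *m invmx Ct) z -> z \is Num.real) /\
  exists u w : R, u != 0 /\
    sp (B *m invmx C) =
      [set real_complex R u * z + real_complex R w | z in sp (Bt *m invmx Ct)].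
Proof.
have Cu := posdef_unitmx C_gt0; have Ctu := posdef_unitmx Ct_gt0.
have [P [P' [u [w [P'P PP' u0 E]]]]] := char_poly_congruence n_ge2 MMt QM QMt.
(* The two matrix sizes are a priori unrelated; they must be identified before [P] can count as an
   invertible square matrix. *)
have mE := linear_bijection_dim P'P PP'; subst mt.
have Pu : P \in unitmx by have [] := mulmx1_unit PP'.
have [M1 _ [_ [_ [_ [_ _ sQ _]]]]] := is_char_poly_qform QM.
have [M2 _ [_ [_ [_ [_ _ sQt _]]]]] := is_char_poly_qform QMt.
have [_ symB _] := symmetric_qpoly sQ; have [_ symBt _] := symmetric_qpoly sQt.
split; first exact: sp_symmetric_pencil_real symB C_gt0.
split; first exact: sp_symmetric_pencil_real symBt Ct_gt0.
exists u, (- w); split=> //.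
have [EC EB] := pencil_congruence u0 E.
apply: (sp_affine_similar u0 (Q := P^T)); first by rewrite unitmx_tr.
exact: pencil_similarity u0 Cu Ctu Pu EC EB.
Qed.
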